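(* Let $\beta>2$ and $q$ an integer with $\beta\sin^2(\frac{\pi}{q})<1$. For any $\nu'\in\mathcal P(\{1,\dots,q\})$ with $\Psi'(\nu')<\Psi'(\frac1q\sum_{k=1}^q\delta_k)$ and any open set $U\subset\mathcal P(\{1,\dots,q\})$ containing $\mathcal G'$, there is a finite time $t\ge0$ with $\phi(t,\nu')\in U$.
   Context: Scalar-product model: $S^1\cong[0,2\pi)$, $\alpha$ Lebesgue measure, $e_s=(\cos s,\sin s)$, $\Phi(\nu)=-\frac\beta2\|\int e_s\nu(ds)\|^2$, $S(\nu|\alpha)$ relative entropy, $\Psi(\nu)=\Phi(\nu)+S(\nu|\alpha)-\inf_{\tilde\nu}(\Phi(\tilde\nu)+S(\tilde\nu|\alpha))$. $S_k=[\tfrac{2\pi}{q}(k-1),\tfrac{2\pi}{q}k)$, $T(\nu)(k)=\nu(S_k)$, indices modulo $q$. For $\nu'\in\mathcal P(\{1,\dots,q\})$, $\nu^{\nu'}$ is the unique minimizer of $\Phi+S(\cdot|\alpha)$ over $\{\nu:T(\nu)=\nu'\}$, $\Psi'(\nu')=\Psi(\nu^{\nu'})$, $\mathcal G'=\operatorname{argmin}\Psi'$ (the periodic orbit). $M_\beta(\nu')=\int e_\omega\nu^{\nu'}(d\omega)$, $c(k,\nu')=e^{\beta\langle e_{2\pi k/q},M_\beta(\nu')\rangle}/\int_{S_k}e^{\beta\langle e_\omega,M_\beta(\nu')\rangle}\alpha(d\omega)$, $F(\nu')(k)=c(k-1,\nu')\nu'(k-1)-c(k,\nu')\nu'(k)$,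 and $\phi(t,\nu')$ solves $\frac{d}{dt}\phi=F(\phi)$, $\phi(0,\nu')=\nu'$. *)

(* Defs.v *)
From HB Require Import structures.
From mathcomp Require Import all_boot all_order all_algebra.
From mathcomp Require Import all_classical all_reals all_analysis.
Unset Printing Implicit Defensive.
Import Order.TTheory GRing.Theory Num.Theory.
Import numFieldNormedType.Exports.
Local Open Scope classical_set_scope.
Local Open Scope ring_scope.

(* The circle S^1 is parametrized by [0, 2 pi); alpha = Lebesgue measure on it.
   A probability measure nu on S^1 with finite relative entropy is represented
   by its density f (w.r.t. alpha); measures that are not absolutely continuous
   have S(nu|alpha) = +oo and play no role in any of the minimisations below. *)

Definition circ (R : realType) : set R := `[0, 2 * pi[%classic.

Definition leb (R : realType) := @lebesgue_measure R.
Definition is_density {R : realType} (f : R -> R) : Prop :=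
  measurable_fun (circ R) f /\ (forall x, circ R x -> 0 <= f x) /\
  (\int[leb R]_(x in circ R) (f x)%:E = 1)%E.

Definition mom_cos {R : realType} (f : R -> R) : R :=
  Rintegral (leb R) (circ R) (fun s => f s * cos s).
Definition mom_sin {R : realType} (f : R -> R) : R :=
  Rintegral (leb R) (circ R) (fun s => f s * sin s).

Definition Phi {R : realType} (beta : R) (f : R -> R) : R :=
  - (beta / 2) * (mom_cos f ^+ 2 + mom_sin f ^+ 2).

(* relative entropy S(nu|alpha) = int f ln f dalpha  (0 ln 0 = 0) *)
Definition relent {R : realType} (f : R -> R) : \bar R :=
  (\int[leb R]_(x in circ R) (f x * ln (f x))%:E)%E.

Definition freeE {R : realType} (beta : R) (f : R -> R) : \bar R :=
  ((Phi beta f)%:E + relent f)%E.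

Definition freeE_inf {R : realType} (beta : R) : \bar R :=
  ereal_inf [set freeE beta f | f in [set g | is_density g]].

Definition Psi {R : realType} (beta : R) (f : R -> R) : \bar R :=
  (freeE beta f - freeE_inf beta)%E.

(* sectors S_k, with k in 'I_q standing for the paper's index k+1:
   S_{k+1} = [2 pi k / q, 2 pi (k+1) / q) *)
Definition sector (R : realType) {q : nat} (k : 'I_q) : set R :=
  `[2 * pi * k%:R / q%:R, 2 * pi * k.+1%:R / q%:R[%classic.

Definition Tproj {R : realType} {q : nat} (f : R -> R) (k : 'I_q) : R :=
  Rintegral (leb R) (sector R k) f.

Definition simplex (R : realType) (q : nat) : set ('I_q -> R) :=
  [set p | (forall i, 0 <= p i) /\ \sum_(i < q) p i = 1].

Definition unif (R : realType) (q : nat) : 'I_q -> R := fun _ => q%:R^-1.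

Definition is_cond_min {R : realType} (beta : R) {q : nat} (p : 'I_q -> R)
  (f : R -> R) : Prop :=
  is_density f /\ (forall k, Tproj f k = p k) /\
  forall g, is_density g -> (forall k, Tproj g k = p k) ->
    (freeE beta f <= freeE beta g)%E.

(* nu^{nu'} : the (unique, by the paper) conditional minimiser *)
Definition nu_of {R : realType} (beta : R) {q : nat} (p : 'I_q -> R) : R -> R :=
  xget (fun _ => 0) (is_cond_min beta p).

Definition Psi' {R : realType} (beta : R) {q : nat} (p : 'I_q -> R) : \bar R :=
  Psi beta (nu_of beta p).

Definition Gset {R : realType} (beta : R) (q : nat) : set ('I_q -> R) :=
  [set p | simplex R q p /\
     forall p', simplex R q p' -> (Psi' beta p <= Psi' beta p')%E].

Definition M1 {R : realType} (beta : R) {q : nat} (p : 'I_q -> R) : R :=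
  mom_cos (nu_of beta p).
Definition M2 {R : realType} (beta : R) {q : nat} (p : 'I_q -> R) : R :=
  mom_sin (nu_of beta p).

(* c(k, nu'); the paper's e_{2 pi k/q} for S_k becomes angle 2 pi (k+1)/q
   with 0-based index k *)
Definition crate {R : realType} (beta : R) {q : nat} (k : 'I_q)
  (p : 'I_q -> R) : R :=
  let a := 2 * pi * k.+1%:R / q%:R in
  expR (beta * (cos a * M1 beta p + sin a * M2 beta p)) /
  Rintegral (leb R) (sector R k)
    (fun w => expR (beta * (cos w * M1 beta p + sin w * M2 beta p))).

(* F(nu')(k) = c(k-1,nu') nu'(k-1) - c(k,nu') nu'(k), indices mod q *)
Definition Fvec {R : realType} (beta : R) {q : nat} (p : 'I_q -> R) :
  'I_q -> R :=
  fun k => crate beta (ord_pred k) p * p (ord_pred k) - crate beta k p * p k.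

Definition is_flow {R : realType} (beta : R) {q : nat} (p : 'I_q -> R)
  (phi : R -> 'I_q -> R) : Prop :=
  (forall i, phi 0 i = p i) /\
  (forall t, 0 <= t -> simplex R q (phi t)) /\
  (forall i, (fun s => phi s i) x @[x --> 0^'+] --> p i) /\
  (forall (i : 'I_q) (t : R), 0 < t -> is_derive t (1 : R) (fun s => phi s i) (Fvec beta (phi t) i)).

Definition rel_open {R : realType} {q : nat} (U : set ('I_q -> R)) : Prop :=
  U `<=` simplex R q /\
  forall x, U x -> exists2 e : R, 0 < e &
    forall y, simplex R q y -> (forall i, `|y i - x i| < e) -> U y.

(* Main.v *)
Require Import Defs.
From HB Require Import structures.
From mathcomp Require Import all_boot all_order all_algebra.
From mathcomp Require Import all_classical all_reals all_analysis.
From mathcomp Require Import measurable_realfun ring lra.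
Set Implicit Arguments.
Unset Strict Implicit.
Import Order.TTheory GRing.Theory Num.Theory.
Import numFieldNormedType.Exports.
Local Open Scope classical_set_scope.
Local Open Scope ring_scope.

(* Write Z_k(m) for the integral of exp(beta <e_w, m>) over the sector S_k and
   G(p, m) = beta/2 |m|^2 - sum_k p_k ln Z_k(m) + sum_k p_k ln p_k.
   By the Gibbs variational principle the conditional minimum of Phi + S over
   {T(nu) = p} is V(p) = min_m G(p, m), and the moment of every conditional
   minimiser minimises G(p, .).  Hence V(phi(s)) <= G(phi(s), M(phi(t))) with
   equality at s = t, so the upper right derivative of V along the flow is
   bounded by a derivative with m frozen.  With r_k = p_k / Z_k(M) and a_k the
   weight at the right end of S_k, summation by parts, ln x <= 2 (sqrt x - 1) and
   the mean-field equation (which gives sum_k a_k (r_(k+1) - r_k) = 0) bound it by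
   - sum_k a_k (sqrt r_(k+1) - sqrt r_k)^2.
   If the dissipation vanishes then r is constant, so p comes from a solution m of
   the mean-field equation on the circle: m = 0 gives the uniform law, which has
   too large a value of V, and m <> 0 is a global minimiser because
   y |-> ln I_0(y) - y^2 / (2 beta) is maximal at any positive critical point.
   If the flow never entered U, compactness would bound the dissipation below by a
   positive constant and V would tend to -oo. *)

(** * Sectors and integration on the circle *)

Lemma continuous_integrable_itv (R : realType) (f : R -> R) (a b : R) (A : set R) :
  continuous f -> measurable A -> A `<=` `[a, b] ->
  (leb R).-integrable A (EFin \o f).
Proof.
move=> cf mA Aab; apply: (@integrableS _ _ _ (leb R) `[a, b]) => //.
apply: continuous_compact_integrable; first exact: segment_compact.
exact: continuous_subspaceT.
Qed.

Lemma measurable_sector (R : realType) q (k : 'I_q) : measurable (sector R k).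
Proof. exact: measurable_itv. Qed.

Lemma measurable_circ (R : realType) : measurable (circ R).
Proof. exact: measurable_itv. Qed.

Lemma sector_circ (R : realType) q (k : 'I_q) : sector R k `<=` circ R.
Proof.
have q0 : (0 < q)%N by case: q k => [[]|].
have qR : (0 : R) < q%:R by rewrite ltr0n.
move=> x; rewrite /sector /circ /= !in_itv /= => /andP[lx xl]; apply/andP; split.
  by apply: le_trans lx; rewrite divr_ge0 ?mulr_ge0 ?pi_ge0 ?ler0n.
apply: lt_le_trans xl _; rewrite ler_pdivrMr// ler_wpM2l ?mulr_ge0 ?pi_ge0//.
by rewrite ler_nat ltn_ord.
Qed.

Lemma circ_seg (R : realType) : circ R `<=` `[0, 2 * pi].
Proof. by move=> x; rewrite /circ /= !in_itv /= => /andP[-> /ltW ->]. Qed.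

Lemma integrable_circ (R : realType) (f : R -> R) :
  continuous f -> (leb R).-integrable (circ R) (EFin \o f).
Proof.
move=> cf; apply: (@continuous_integrable_itv _ _ 0 (2 * pi)) => //.
  exact: measurable_circ.
exact: circ_seg.
Qed.

Lemma integrable_sectorS (R : realType) q (k : 'I_q) (f : R -> R) :
  (leb R).-integrable (circ R) (EFin \o f) ->
  (leb R).-integrable (sector R k) (EFin \o f).
Proof.
apply: integrableS; [exact: measurable_circ|exact: measurable_sector|].
exact: sector_circ.
Qed.

(** Induction over the initial arcs [[0, pt n[], each longer than the last by one sector. *)
Lemma Rintegral_circ_sectors (R : realType) q (f : R -> R) : (0 < q)%N ->
  (leb R).-integrable (circ R) (EFin \o f) ->
  Rintegral (leb R) (circ R) f = \sum_(k < q) Rintegral (leb R) (sector R k) f.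
Proof.
move=> q0 fi; have qR : (0 : R) < q%:R by rewrite ltr0n.
pose pt n : R := 2 * pi * n%:R / q%:R.
have ptle m n : (m <= n)%N -> pt m <= pt n.
  move=> mn; rewrite /pt ler_pM2r ?invr_gt0// ler_wpM2l ?mulr_ge0 ?pi_ge0//.
  by rewrite ler_nat.
have pt0 : pt 0%N = 0 by rewrite /pt mulr0 mul0r.
have ptq : pt q = 2 * pi by rewrite /pt mulfK// gt_eqF.
have key n : (n <= q)%N -> Rintegral (leb R) `[0, pt n[ f =
    \sum_(k < n) Rintegral (leb R) `[pt k, pt k.+1[ f.
  elim: n => [_|n IH nq].
    by rewrite pt0 set_itvco0 Rintegral_set0 big_ord0.
  rewrite big_ord_recr /= -IH; last exact: ltnW.
  have sp : `[0, pt n.+1[%classic =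
      `[0, pt n[%classic `|` `[pt n, pt n.+1[%classic :> set R.
    rewrite -itv_bndbnd_setU// bnd_simp; last exact: ptle.
    by rewrite -pt0 ptle.
  rewrite sp Rintegral_setU//.
    rewrite -sp; apply: integrableS fi => //; first exact: measurable_circ.
    by apply: subset_itvl; rewrite bnd_simp -ptq ptle.
  apply/disj_setPS => y [/=]; rewrite !in_itv/= => /andP[_ yx] /andP[].
  by rewrite leNgt yx.
by rewrite /circ -ptq key.
Qed.

Lemma Rintegral_itvco_cc (R : realType) (f : R -> R) (a b : R) :
  continuous f ->
  Rintegral (leb R) `[a, b[ f = Rintegral (leb R) `[a, b] f.
Proof.
move=> cf; apply: Rintegral_itv_bndo_bndc.
apply: (@continuous_integrable_itv _ _ a b) => //.
by apply: subset_itvl; rewrite bnd_simp.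
Qed.

Lemma Rintegral_derive_itvco (R : realType) (f F : R -> R) (a b : R) : a < b ->
  continuous f -> (forall x, a <= x <= b -> is_derive x (1 : R) F (f x)) ->
  Rintegral (leb R) `[a, b[ f = F b - F a.
Proof.
move=> ab cf dF; rewrite Rintegral_itvco_cc// /Rintegral.
have cF x : a <= x <= b -> {for x, continuous F}.
  by move=> /dF[dx _]; apply/differentiable_continuous/derivable1_diffP.
rewrite (@continuous_FTC2 _ f F)//.
- exact: continuous_subspaceT.
- split.
  + move=> x; rewrite in_itv/= => /andP[/ltW ? /ltW ?].
    by case: (dF x) => //; apply/andP.
  + by apply/cvg_at_right_filter/cF; rewrite lexx ltW.
  + by apply/cvg_at_left_filter/cF; rewrite lexx ltW.
- move=> x; rewrite in_itv/= => /andP[/ltW ? /ltW ?]; rewrite derive1E.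
  by case: (dF x) => //; apply/andP.
Qed.

Lemma sector_uniq (R : realType) q (j k : 'I_q) (x : R) :
  sector R j x -> sector R k x -> j = k.
Proof.
have q0 : (0 < q)%N by case: q j {k} => [[]|].
have qR : (0 : R) < q%:R by rewrite ltr0n.
have c0 : (0 : R) < 2 * pi by rewrite mulr_gt0 ?pi_gt0.
suff half (i l : 'I_q) : sector R i x -> sector R l x -> (i <= l)%N.
  by move=> ? ?; apply/val_inj/eqP; rewrite eqn_leq !half.
rewrite /sector /= !in_itv /= => /andP[h _] /andP[_ h'].
have := le_lt_trans h h'.
by rewrite ltr_pM2r ?invr_gt0// ltr_pM2l// ltr_nat.
Qed.

Lemma circ_sector (R : realType) q (x : R) : (0 < q)%N -> circ R x ->
  exists k : 'I_q, sector R k x.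
Proof.
move=> q0; have qR : (0 : R) < q%:R by rewrite ltr0n.
have c0 : (0 : R) < 2 * pi by rewrite mulr_gt0 ?pi_gt0.
rewrite /circ /= in_itv /= => /andP[x0 x2].
(* The index sought is the integer part of x measured in units of the sector length 2 pi / q. *)
have y0 : 0 <= x * q%:R / (2 * pi).
  by apply: divr_ge0; [exact: mulr_ge0 x0 (ltW qR)|exact: ltW].
have /andP[h1 h2] := truncn_itv y0.
have kq : (Num.truncn (x * q%:R / (2 * pi)) < q)%N.
  rewrite -(ltr_nat R); apply: le_lt_trans h1 _.
  by rewrite ltr_pdivrMr// mulrC ltr_pM2l.
exists (Ordinal kq); rewrite /sector /= in_itv /=; apply/andP; split.
  by rewrite ler_pdivrMr// mulrC -ler_pdivlMr.
by rewrite ltr_pdivlMr// mulrC (mulrC _ (_.+1%:R)) -ltr_pdivrMr// mulrC.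
Qed.

Lemma sector_measure (R : realType) q (k : 'I_q) :
  fine (leb R (sector R k)) = 2 * pi / q%:R.
Proof.
have q0 : (0 < q)%N by case: q k => [[]|].
have qR : (0 : R) < q%:R by rewrite ltr0n.
have c0 : (0 : R) < 2 * pi by rewrite mulr_gt0 ?pi_gt0.
have lt : 2 * pi * k%:R / q%:R < 2 * pi * k.+1%:R / q%:R :> R.
  by rewrite ltr_pM2r ?invr_gt0// ltr_pM2l// ltr_nat.
rewrite /leb /sector lebesgue_measure_itv/= lte_fin lt /=.
by rewrite -mulrBl -mulrBr -natrB// subSnn mulr1.
Qed.

(** Written as a sum of indicators so that measurability and the bound [step_le] can be had
    termwise; disjointness of the sectors gives back the value in [stepE]. *)
Definition step {R : realType} {q : nat} (c : 'I_q -> R) (x : R) : R :=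
  \sum_(k < q) c k * \1_(sector R k) x.

Lemma stepE (R : realType) q (c : 'I_q -> R) (k : 'I_q) (x : R) :
  sector R k x -> step c x = c k.
Proof.
move=> kx; rewrite /step (bigD1 k)//= indicE mem_set// mulr1 big1 ?addr0//.
move=> j jk; rewrite indicE memNset ?mulr0// => jx.
by move/eqP: jk; apply; exact: sector_uniq jx kx.
Qed.

Lemma measurable_step (R : realType) q (c : 'I_q -> R) :
  measurable_fun setT (step c).
Proof.
apply: measurable_sum => k; apply: measurable_funM; first exact: measurable_cst.
by apply: measurable_indic; exact: measurable_sector.
Qed.

Lemma step_le (R : realType) q (c : 'I_q -> R) (x : R) :
  `|step c x| <= \sum_(k < q) `|c k|.
Proof.
rewrite /step; apply: le_trans (ler_norm_sum _ _ _) _; apply: ler_sum => k _.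
by rewrite normrM indicE; case: (_ \in _); rewrite ?normr1 ?normr0 ?mulr1 ?mulr0.
Qed.

Section real_integrable.
Context (R : realType) (D : set R) (mD : measurable D).
Implicit Types f g : R -> R.
Local Notation intg h := ((leb R).-integrable D (EFin \o h)).

Lemma integrable_RZ (c : R) f : intg f -> intg (fun x => c * f x).
Proof.
move=> fi; rewrite (_ : _ \o _ = fun x => (c%:E * (EFin \o f) x)%E)//.
exact: integrableZl.
Qed.

Lemma integrable_RD f g : intg f -> intg g -> intg (fun x => f x + g x).
Proof.
move=> fi gi; rewrite (_ : _ \o _ = ((EFin \o f) \+ (EFin \o g))%E)//.
exact: integrableD.
Qed.

Lemma integrable_RB f g : intg f -> intg g -> intg (fun x => f x - g x).
Proof.
move=> fi gi; rewrite (_ : _ \o _ = ((EFin \o f) \- (EFin \o g))%E)//.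
exact: integrableB.
Qed.

Lemma integrable_RM f g (M : R) : intg f -> measurable_fun D g ->
  (forall x, D x -> `|g x| <= M) -> intg (fun x => f x * g x).
Proof.
move=> fi mg gM; rewrite (_ : _ \o _ = ((EFin \o f) \* (EFin \o g))%E)//.
apply: integrableMl => //.
exists M; split; first exact: num_real.
by move=> y My x Dx /=; apply: le_trans (gM _ Dx) (ltW My).
Qed.

Lemma eq_Rint f g : (forall x, D x -> f x = g x) ->
  Rintegral (leb R) D f = Rintegral (leb R) D g.
Proof. by move=> fg; apply: eq_Rintegral => x /set_mem; exact: fg. Qed.

Lemma RintZ (c : R) f : intg f ->
  Rintegral (leb R) D (fun x => c * f x) = c * Rintegral (leb R) D f.
Proof. by move=> fi; rewrite RintegralZl. Qed.

Lemma RintD f g : intg f -> intg g ->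
  Rintegral (leb R) D (fun x => f x + g x) =
  Rintegral (leb R) D f + Rintegral (leb R) D g.
Proof. by move=> fi gi; rewrite RintegralD. Qed.

Lemma RintB f g : intg f -> intg g ->
  Rintegral (leb R) D (fun x => f x - g x) =
  Rintegral (leb R) D f - Rintegral (leb R) D g.
Proof. by move=> fi gi; rewrite RintegralB. Qed.

Lemma le_Rint f g : intg f -> intg g -> (forall x, D x -> f x <= g x) ->
  Rintegral (leb R) D f <= Rintegral (leb R) D g.
Proof. by move=> fi gi fg; apply: le_Rintegral. Qed.

Lemma norm_Rint_le f : intg f ->
  `|Rintegral (leb R) D f| <= Rintegral (leb R) D (fun x => `|f x|).
Proof. by move=> fi; apply: le_normr_Rintegral. Qed.

End real_integrable.

(** * Gibbs variational principle *)

Definition tilt {R : realType} (b : R) (m : R * R) (w : R) : R :=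
  b * (cos w * m.1 + sin w * m.2).

Definition weight {R : realType} (b : R) (m : R * R) (w : R) : R :=
  expR (tilt b m w).

Definition Zsec {R : realType} {q : nat} (b : R) (k : 'I_q) (m : R * R) : R :=
  Rintegral (leb R) (sector R k) (weight b m).

Lemma continuous_tilt (R : realType) (b : R) (m : R * R) : continuous (tilt b m).
Proof.
move=> x; rewrite /continuous_at /tilt; apply: cvgM; first exact: cvg_cst.
by apply: cvgD; (apply: cvgM; last exact: cvg_cst);
  [exact: continuous_cos|exact: continuous_sin].
Qed.

Lemma continuous_weight (R : realType) (b : R) (m : R * R) :
  continuous (weight b m).
Proof.
move=> x; apply: continuous_comp; first exact: continuous_tilt.
exact: continuous_expR.
Qed.

Lemma weight_gt0 (R : realType) (b : R) (m : R * R) w : 0 < weight b m w.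
Proof. exact: expR_gt0. Qed.

Lemma integrable_weight (R : realType) (b : R) (m : R * R) q (k : 'I_q) :
  (leb R).-integrable (sector R k) (EFin \o weight b m).
Proof. exact/integrable_sectorS/integrable_circ/continuous_weight. Qed.

Lemma tilt_lip (R : realType) (b : R) (m m' : R * R) (w : R) :
  `|tilt b m' w - tilt b m w| <= `|b| * (`|m'.1 - m.1| + `|m'.2 - m.2|).
Proof.
have -> : tilt b m' w - tilt b m w =
    b * (cos w * (m'.1 - m.1) + sin w * (m'.2 - m.2)).
  by rewrite /tilt; ring.
rewrite normrM ler_wpM2l// (le_trans (ler_normD _ _))// !normrM lerD//.
  by rewrite ler_piMl// ler_norml cos_geN1 cos_le1.
by rewrite ler_piMl// ler_norml sin_geN1 sin_le1.
Qed.

Lemma Zsec0 (R : realType) (b : R) q (k : 'I_q) :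
  Zsec b k (0, 0) = 2 * pi / q%:R.
Proof.
rewrite /Zsec (@eq_Rintegral _ _ _ _ _ (cst 1)); last first.
  by move=> x _; rewrite /weight /tilt !mulr0 addr0 mulr0 expR0.
by rewrite Rintegral_cst ?mul1r ?sector_measure//; exact: measurable_sector.
Qed.

(** The Lipschitz bound on the exponent, integrated. Comparison with m = 0 yields positivity of
    [Zsec], and taking logarithms yields Lipschitz continuity of ln Z with no limit under the
    integral. *)
Lemma Zsec_comp (R : realType) (b : R) q (k : 'I_q) (m m' : R * R) :
  Zsec b k m <= expR (`|b| * (`|m'.1 - m.1| + `|m'.2 - m.2|)) * Zsec b k m'.
Proof.
have mS := @measurable_sector R q k.
rewrite /Zsec -RintegralZl//; last exact: integrable_weight.
apply: le_Rintegral => //; first exact: integrable_weight.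
  exact/integrable_RZ/integrable_weight.
move=> x _; rewrite /weight -expRD ler_expR -lerBlDr.
by rewrite (le_trans (ler_norm _))// distrC tilt_lip.
Qed.

Lemma Zsec_gt0 (R : realType) (b : R) q (k : 'I_q) (m : R * R) : 0 < Zsec b k m.
Proof.
have q0 : (0 < q)%N by case: q k => [[]|].
have := Zsec_comp b k (0, 0) m; rewrite Zsec0 => h.
have : 0 < 2 * pi / q%:R :> R by rewrite divr_gt0 ?mulr_gt0 ?pi_gt0 ?ltr0n.
by move=> /lt_le_trans/(_ h); rewrite pmulr_rgt0 ?expR_gt0.
Qed.

Lemma lnZ_lip (R : realType) (b : R) q (k : 'I_q) (m m' : R * R) :
  `|ln (Zsec b k m) - ln (Zsec b k m')| <=
    `|b| * (`|m'.1 - m.1| + `|m'.2 - m.2|).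
Proof.
suff half x y : ln (Zsec b k x) - ln (Zsec b k y) <=
    `|b| * (`|y.1 - x.1| + `|y.2 - x.2|).
  rewrite ler_norml half andbT lerNl opprB; apply: le_trans (half _ _) _.
  by rewrite (distrC m.1) (distrC m.2).
have := Zsec_comp b k x y; move: (Zsec_gt0 b k x) (Zsec_gt0 b k y).
move: (Zsec b k x) (Zsec b k y) => u v u0 v0 uv.
by rewrite lerBlDr -ler_expR expRD !lnK.
Qed.

(** The entropy integrand need not be integrable, so monotonicity is applied to its positive and
    negative parts separately. *)
Lemma Rintegral_le_relent (R : realType) (f l : R -> R) :
  measurable_fun (circ R) f -> (leb R).-integrable (circ R) (EFin \o l) ->
  (forall x, circ R x -> l x <= f x * ln (f x)) ->
  ((Rintegral (leb R) (circ R) l)%:E <= relent f)%E.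
Proof.
move=> mf li lf.
rewrite /Rintegral fineK; first last.
  by apply: integrable_fin_num => //; exact: measurable_circ.
have mh : measurable_fun (circ R) (EFin \o (fun x => f x * ln (f x))).
  apply/measurable_EFinP/measurable_funM => //.
  by apply: measurableT_comp => //; exact: measurable_ln.
have ml := measurable_int _ li.
have lf' x : circ R x -> (((l x)%:E : \bar R) <= (f x * ln (f x))%:E)%E.
  by move=> Dx; rewrite lee_fin lf.
rewrite /relent integralE [leRHS]integralE leeB//.
- apply: ge0_le_integral => //; first exact: measurable_circ.
  + exact: measurable_funepos.
  + exact: measurable_funepos.
  + move=> x Dx; apply: funepos_le; last exact/mem_set/Dx.
    by move=> y /set_mem; exact: lf'.
- apply: ge0_le_integral => //; first exact: measurable_circ.
  + exact: measurable_funeneg.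
  + exact: measurable_funeneg.
  + move=> x Dx; apply: funeneg_le; last exact/mem_set/Dx.
    by move=> y /set_mem; exact: lf'.
Qed.

Lemma density_integrable (R : realType) (f : R -> R) : is_density f ->
  (leb R).-integrable (circ R) (EFin \o f).
Proof.
case=> mf [f0 f1]; apply/integrableP; split; first exact/measurable_EFinP.
have -> : (\int[leb R]_(x in circ R) `|(EFin \o f) x| =
    \int[leb R]_(x in circ R) (f x)%:E)%E.
  by apply: eq_integral => x /set_mem xc /=; rewrite ger0_norm// f0.
by rewrite f1 ltry.
Qed.

Lemma measurable_cosD (R : realType) (D : set R) : measurable_fun D (@cos R).
Proof.
by apply: measurable_funTS; apply: continuous_measurable_fun; exact: continuous_cos.
Qed.

Lemma measurable_sinD (R : realType) (D : set R) : measurable_fun D (@sin R).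
Proof.
by apply: measurable_funTS; apply: continuous_measurable_fun; exact: continuous_sin.
Qed.

Lemma integrable_density_cos (R : realType) (f : R -> R) (D : set R) :
  (leb R).-integrable D (EFin \o f) -> measurable D ->
  (leb R).-integrable D (EFin \o (fun x => f x * cos x)).
Proof.
move=> fi mD; apply: (@integrable_RM _ _ mD _ _ 1) => //.
  exact: measurable_cosD.
by move=> x _; rewrite ler_norml cos_geN1 cos_le1.
Qed.

Lemma integrable_density_sin (R : realType) (f : R -> R) (D : set R) :
  (leb R).-integrable D (EFin \o f) -> measurable D ->
  (leb R).-integrable D (EFin \o (fun x => f x * sin x)).
Proof.
move=> fi mD; apply: (@integrable_RM _ _ mD _ _ 1) => //.
  exact: measurable_sinD.
by move=> x _; rewrite ler_norml sin_geN1 sin_le1.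
Qed.

Lemma density_mass (R : realType) (f : R -> R) : is_density f ->
  Rintegral (leb R) (circ R) f = 1.
Proof. by case=> _ [_ h]; rewrite /Rintegral h. Qed.

(** A compact square containing the moment of every density, so that G can be minimised over it
    without losing any relevant m. *)
Definition box {R : realType} (m : R * R) : Prop := `|m.1| <= 1 /\ `|m.2| <= 1.

Definition mom {R : realType} (f : R -> R) : R * R := (mom_cos f, mom_sin f).

Lemma mom_box (R : realType) (f : R -> R) : is_density f -> box (mom f).
Proof.
move=> df; have fi := density_integrable df; have mC := @measurable_circ R.
have [_ [f0 _]] := df.
have key (g : R -> R) : measurable_fun (circ R) g -> (forall x, `|g x| <= 1) ->
    `|Rintegral (leb R) (circ R) (fun x => f x * g x)| <= 1.
  move=> mg g1; have gi := integrable_RM mC fi mg (fun x _ => g1 x).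
  rewrite -[leRHS](density_mass df).
  apply: le_trans (norm_Rint_le mC gi) _.
  apply: le_Rint => //; first exact: integrable_norm.
  by move=> x xc; rewrite normrM (ger0_norm (f0 _ xc)) ler_piMr ?f0.
split; apply: key => [|x]; rewrite ?ler_norml ?cos_geN1 ?cos_le1 ?sin_geN1 ?sin_le1//.
  exact: measurable_cosD.
exact: measurable_sinD.
Qed.

Lemma Rintegral_density_tilt (R : realType) (b : R) (m : R * R) (f : R -> R) :
  is_density f ->
  Rintegral (leb R) (circ R) (fun x => f x * tilt b m x) =
  b * (m.1 * mom_cos f + m.2 * mom_sin f).
Proof.
move=> df; have fi := density_integrable df; have mC := @measurable_circ R.
have ci := integrable_density_cos fi mC; have si := integrable_density_sin fi mC.
rewrite (@eq_Rint _ _ _ (fun x => (b * m.1) * (f x * cos x) +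
    (b * m.2) * (f x * sin x))); last by move=> x _; rewrite /tilt; ring.
rewrite RintD//; try exact: integrable_RZ.
by rewrite !RintZ// /mom_cos /mom_sin; ring.
Qed.

Lemma integrable_step (R : realType) q (c : 'I_q -> R) (f : R -> R) :
  (leb R).-integrable (circ R) (EFin \o f) ->
  (leb R).-integrable (circ R) (EFin \o (fun x => f x * step c x)).
Proof.
move=> fi; apply: (integrable_RM (@measurable_circ R) fi (M := \sum_k `|c k|)).
  by apply: measurable_funTS; exact: measurable_step.
by move=> x _; exact: step_le.
Qed.

Lemma Rintegral_step (R : realType) q (c : 'I_q -> R) (f : R -> R) : (0 < q)%N ->
  (leb R).-integrable (circ R) (EFin \o f) ->
  Rintegral (leb R) (circ R) (fun x => f x * step c x) =
  \sum_(k < q) c k * Tproj f k.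
Proof.
move=> q0 fi; rewrite (Rintegral_circ_sectors q0); last exact: integrable_step.
apply: eq_bigr => k _; rewrite (@eq_Rint _ _ _ (fun x => c k * f x)); last first.
  by move=> x kx; rewrite (stepE c kx) mulrC.
by rewrite RintZ//; [exact: measurable_sector|exact: integrable_sectorS].
Qed.

Lemma integrable_tilt (R : realType) (b : R) (m : R * R) (f : R -> R) :
  (leb R).-integrable (circ R) (EFin \o f) ->
  (leb R).-integrable (circ R) (EFin \o (fun x => f x * tilt b m x)).
Proof.
move=> fi; apply: (integrable_RM (@measurable_circ R) fi
    (M := `|b| * (`|m.1| + `|m.2|))).
  by apply: measurable_funTS; apply: continuous_measurable_fun; exact: continuous_tilt.
move=> x _; have := tilt_lip b (0, 0) m x.
by rewrite /= !subr0 {2}/tilt !mulr0 addr0 mulr0 subr0.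
Qed.

(** The convex function x ln x lies above its tangent at w; for x > 0 this is ln (w / x) <= w / x -
    1. *)
Lemma xlnx_tangent (R : realType) (x w : R) : 0 <= x -> 0 < w ->
  x * ln w + x - w <= x * ln x.
Proof.
rewrite le_eqVlt => /predU1P[<-|x0] w0.
  by rewrite !mul0r !add0r oppr_le0 ltW.
have := @le_ln1Dx R (w / x - 1); rewrite addrCA subrr addr0 ln_div ?posrE// => h.
have /h : -1 < w / x - 1 by rewrite ltrDr divr_gt0.
rewrite -(ler_pM2l x0) mulrBr mulrBr mulr1 mulrCA mulfV ?gt_eqF// mulr1.
by lra.
Qed.

(* G(p, m) satisfies inf_m G(p, m) = inf {freeE f | Tproj f = p}: it linearises
   -beta/2 |M|^2 as the minimum over m of beta/2 |m|^2 - beta <m, M>. *)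
Definition Gfun {R : realType} {q : nat} (b : R) (p : 'I_q -> R) (m : R * R) : R :=
  b / 2 * (m.1 ^+ 2 + m.2 ^+ 2) - \sum_k p k * ln (Zsec b k m) +
  \sum_k p k * ln (p k).

(** The tangent inequality is integrated against the reference density equal to [c k * weight b m]
    on sector k. The constants are such that the masses of the two densities cancel up to e. *)
Lemma relent_ge (R : realType) q (b : R) (p : 'I_q -> R) (m : R * R) (f : R -> R) :
  (0 < q)%N -> is_density f -> (forall k, Tproj f k = p k) ->
  (forall k, 0 <= p k) ->
  ((b * (m.1 * mom_cos f + m.2 * mom_sin f) - \sum_k p k * ln (Zsec b k m) +
    \sum_k p k * ln (p k))%:E <= relent f)%E.
Proof.
move=> q0 df fp p0; apply/lee_addgt0Pr => e e0.
have fi := density_integrable df; have mC := @measurable_circ R.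
have wi : (leb R).-integrable (circ R) (EFin \o weight b m).
  exact/integrable_circ/continuous_weight.
have qR : (0 : R) < q%:R by rewrite ltr0n.
pose d := e / q%:R; have d0 : 0 < d by rewrite divr_gt0.
(* shifting p by d keeps the reference density positive where p k = 0 *)
pose c (k : 'I_q) := (p k + d) / Zsec b k m.
have c0 k : 0 < c k by rewrite divr_gt0 ?Zsec_gt0// ltr_wpDl.
(* [l] is the tangent minorant f ln w + f - w for the reference density w. *)
pose l x := f x * tilt b m x + f x * step (fun k => ln (c k) + 1) x -
  weight b m x * step c x.
have ti := integrable_tilt b m fi.
have si := integrable_step (fun k => ln (c k) + 1) fi.
have ci := integrable_step c wi.
have li : (leb R).-integrable (circ R) (EFin \o l).
  by apply: integrable_RB => //; exact: integrable_RD.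
have lf x : circ R x -> l x <= f x * ln (f x).
  move=> xc; have [k kx] := circ_sector q0 xc.
  have f0 : 0 <= f x by case: df => _ [+ _]; exact.
  have w0 : 0 < c k * weight b m x by rewrite mulr_gt0 ?weight_gt0.
  have := xlnx_tangent f0 w0.
  rewrite lnM ?posrE ?weight_gt0// {1}/weight expRK.
  by rewrite /l !(stepE _ kx); lra.
have := Rintegral_le_relent (proj1 df) li lf.
rewrite /l RintB//; last exact: integrable_RD.
rewrite RintD// Rintegral_density_tilt// !Rintegral_step// => h.
have cZ : \sum_k c k * Tproj (weight b m) k = \sum_k (p k + d).
  by apply: eq_bigr => k _; rewrite /c divfK// gt_eqF// Zsec_gt0.
(* The q shifts by d add up to e, the slack allowed at the start. *)
rewrite cZ big_split/= sumr_const card_ord -mulr_natr divfK ?gt_eqF// in h.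
rewrite -leeBlDr//; apply: le_trans h; rewrite -EFinB lee_fin.
have : \sum_k p k * ln (p k) - \sum_k p k * ln (Zsec b k m) <=
    \sum_k (ln (c k) + 1) * Tproj f k - \sum_k p k.
  rewrite -!sumrB; apply: ler_sum => k _; rewrite fp /c ln_div ?posrE ?Zsec_gt0//;
    last by rewrite ltr_wpDl.
  have : p k * ln (p k) <= p k * ln (p k + d).
    have := p0 k; rewrite le_eqVlt => /predU1P[<-|pk]; first by rewrite !mul0r.
    by rewrite ler_pM2l// ler_ln ?posrE ?lerDl ?ltW// ltr_wpDl// ltW.
  by lra.
by lra.
Qed.

(** With m equal to the moment of f, the linear term of [relent_ge] is b |m|^2, and adding [Phi]
    leaves b/2 |m|^2. *)
Lemma freeE_ge (R : realType) q (b : R) (p : 'I_q -> R) (f : R -> R) :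
  (0 < q)%N -> is_density f -> (forall k, Tproj f k = p k) ->
  (forall k, 0 <= p k) -> ((Gfun b p (mom f))%:E <= Defs.freeE b f)%E.
Proof.
move=> q0 df fp p0.
have := leeD2l ((Phi b f)%:E) (relent_ge b (mom f) q0 df fp p0).
apply: le_trans; rewrite -EFinD lee_fin /Gfun /Phi /mom /= le_eqVlt; apply/orP; left.
by apply/eqP; field.
Qed.

(** The equality case of the entropy bound: on each sector, the exponential weight rescaled to have
    mass p k. *)
Definition gibbs {R : realType} {q : nat} (b : R) (p : 'I_q -> R) (m : R * R)
  (x : R) : R := weight b m x * step (fun k => p k / Zsec b k m) x.

Lemma integrable_gibbs (R : realType) q (b : R) (p : 'I_q -> R) (m : R * R) :
  (leb R).-integrable (circ R) (EFin \o gibbs b p m).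
Proof. exact/integrable_step/integrable_circ/continuous_weight. Qed.

Lemma Tproj_gibbs (R : realType) q (b : R) (p : 'I_q -> R) (m : R * R) k :
  Tproj (gibbs b p m) k = p k.
Proof.
rewrite /Tproj (@eq_Rint _ _ _ (fun x => p k / Zsec b k m * weight b m x)).
  rewrite RintZ; [|exact: measurable_sector|exact: integrable_weight].
  by rewrite divfK// gt_eqF// Zsec_gt0.
by move=> x kx; rewrite /gibbs (stepE _ kx) mulrC.
Qed.

Lemma density_gibbs (R : realType) q (b : R) (p : 'I_q -> R) (m : R * R) :
  (0 < q)%N -> simplex R q p -> is_density (gibbs b p m).
Proof.
move=> q0 [p0 p1]; have gi := integrable_gibbs b p m.
split; first by have /measurable_int/measurable_EFinP := gi.
split=> [x xc|].
  have [k kx] := circ_sector q0 xc.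
  by rewrite /gibbs (stepE _ kx) mulr_ge0 ?divr_ge0// ltW// ?weight_gt0 ?Zsec_gt0.
have -> : (\int[leb R]_(x in circ R) (gibbs b p m x)%:E)%E =
    (Rintegral (leb R) (circ R) (gibbs b p m))%:E.
  rewrite /Rintegral fineK//; apply: integrable_fin_num => //.
  exact: measurable_circ.
rewrite (Rintegral_circ_sectors q0)// -p1; congr _%:E.
by apply: eq_bigr => k _; exact: Tproj_gibbs.
Qed.

(** On sector k the logarithm of the density is ln (p k / Z_k) plus the tilt, so the entropy is
    explicit; completing the square with [Phi] leaves the defect in the moment. Sectors with p k = 0
    contribute nothing to either side. *)
Lemma freeE_gibbs (R : realType) q (b : R) (p : 'I_q -> R) (m : R * R) :
  (0 < q)%N -> simplex R q p ->
  Defs.freeE b (gibbs b p m) = (Gfun b p m - b / 2 *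
    ((mom_cos (gibbs b p m) - m.1) ^+ 2 + (mom_sin (gibbs b p m) - m.2) ^+ 2))%:E.
Proof.
move=> q0 sp; have df := density_gibbs b m q0 sp; have [p0 p1] := sp.
have gi := integrable_gibbs b p m; have mC := @measurable_circ R.
set f := gibbs b p m in df gi *.
pose c k := ln (p k / Zsec b k m).
have ti := integrable_tilt b m gi; have si := integrable_step c gi.
rewrite /Defs.freeE.
have -> : relent f = (Rintegral (leb R) (circ R)
    (fun x => f x * step c x + f x * tilt b m x))%:E.
  rewrite /Rintegral fineK; last first.
    by apply: integrable_fin_num => //; exact: integrable_RD.
  apply: eq_integral => x /set_mem xc; congr _%:E.
  have [k kx] := circ_sector q0 xc.
  rewrite /f /gibbs !(stepE _ kx) /c.
  have [->|pk] := eqVneq (p k) 0; first by rewrite !(mul0r, mulr0) addr0.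
  have pk0 : 0 < p k by rewrite lt_neqAle eq_sym pk p0.
  rewrite lnM ?posrE ?weight_gt0 ?divr_gt0 ?Zsec_gt0// {2}/weight expRK.
  by rewrite mulrDr addrC.
rewrite RintD// Rintegral_density_tilt// Rintegral_step// -EFinD; congr _%:E.
have -> : \sum_k c k * Tproj f k =
    \sum_k p k * ln (p k) - \sum_k p k * ln (Zsec b k m).
  rewrite -sumrB; apply: eq_bigr => k _; rewrite Tproj_gibbs /c.
  have [->|pk] := eqVneq (p k) 0; first by rewrite !(mul0r, mulr0) subr0.
  have pk0 : 0 < p k by rewrite lt_neqAle eq_sym pk p0.
  by rewrite ln_div ?posrE ?Zsec_gt0//; ring.
by rewrite /Gfun /Phi; field.
Qed.

(** * Minimisers of G *)

Section convergence.
Context (R : realType) (T : Type) (F : set_system T) (FF : Filter F).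

Lemma cvg_ord_sum q (f : 'I_q -> T -> R) (a : 'I_q -> R) :
  (forall k, f k x @[x --> F] --> a k) ->
  (\sum_k f k x) @[x --> F] --> \sum_k a k.
Proof.
elim: q f a => [|q IH] f a fa.
  under eq_fun do rewrite big_ord0; rewrite big_ord0; exact: cvg_cst.
under eq_fun do rewrite big_ord_recl; rewrite big_ord_recl.
by apply: cvgD; [exact: fa|apply: IH => k; exact: fa].
Qed.

Lemma cvg_lnZ q (b : R) (k : 'I_q) (f : T -> R * R) (m : R * R) :
  (f x).1 @[x --> F] --> m.1 -> (f x).2 @[x --> F] --> m.2 ->
  ln (Zsec b k (f x)) @[x --> F] --> ln (Zsec b k m).
Proof.
move=> f1 f2; apply/cvgrPdist_le => e e0.
have d0 : 0 < e / (2 * (`|b| + 1)).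
  by rewrite divr_gt0// mulr_gt0// ltr_wpDl.
near=> x; apply: le_trans (lnZ_lip _ _ _ _) _.
have h1 : `|m.1 - (f x).1| <= e / (2 * (`|b| + 1)).
  by near: x; move/cvgrPdist_le : f1; exact.
have h2 : `|m.2 - (f x).2| <= e / (2 * (`|b| + 1)).
  by near: x; move/cvgrPdist_le : f2; exact.
rewrite distrC in h1; rewrite distrC in h2.
have b1 : 0 < `|b| + 1 by rewrite ltr_wpDl.
have -> : e = (`|b| + 1) * (e / (2 * (`|b| + 1)) + e / (2 * (`|b| + 1))).
  by field; rewrite gt_eqF.
apply: ler_pM => //; first by rewrite lerDl.
exact: lerD.
Unshelve. all: by end_near. Qed.

Lemma continuous_xlnx (a : R) : (x * ln x) @[x --> a] --> a * ln a.
Proof.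
have [a0|a0|->] := ltgtP a 0.
- rewrite ln0 ?ltW// mulr0; apply: cvg_near_cst; near=> x.
  by rewrite ln0 ?mulr0// ltW//; near: x; exact: lt_nbhsl.
- by apply: cvgM; [exact: cvg_id|exact: continuous_ln].
- rewrite mul0r; apply/cvgrPdist_le => e e0.
  (* For 0 < x <= 1 and s = sqrt x, one has |x ln x| = 2 s (s (- ln s)) <= 2 s, because - ln s <= 1
     / s; hence sqrt x <= e / 2 suffices. *)
  pose d := Num.min 1 ((e / 2) ^+ 2).
  have d0 : 0 < d by rewrite lt_min ltr01 exprn_gt0// divr_gt0.
  have nd : \forall x \near (0 : R), `|x| <= d.
    have /cvgrPdist_le/(_ _ d0) := @cvg_id _ (nbhs (0 : R)).
    by apply: filterS => x; rewrite sub0r normrN.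
  near=> x.
  have : `|x| <= d.
    by near: x; exact: nd.
  rewrite le_min => /andP[x1 xe]; rewrite sub0r normrN.
  have [x0|x0] := leP x 0; first by rewrite ln0// mulr0 normr0 ltW.
  rewrite gtr0_norm// in x1 xe.
  have s0 : 0 < Num.sqrt x by rewrite sqrtr_gt0.
  have se : Num.sqrt x <= e / 2.
    have e2 : 0 <= e / 2 by rewrite divr_ge0// ltW.
    by rewrite -ler_sqr ?nnegrE ?sqrtr_ge0// sqr_sqrtr// ltW.
  have lns : ln (Num.sqrt x)^-1 <= (Num.sqrt x)^-1.
    by apply/ltW/ln_sublinear; rewrite invr_gt0.
  rewrite lnV ?posrE// in lns.
  have lx : ln x = 2 * ln (Num.sqrt x).
    by rewrite -{1}(sqr_sqrtr (ltW x0)) lnXn// mulr_natl.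
  rewrite normrM gtr0_norm// ler0_norm ?ln_le0// lx -mulrN.
  rewrite -[X in X * _](sqr_sqrtr (ltW x0)).
  have : Num.sqrt x * (- ln (Num.sqrt x)) <= 1.
    by rewrite -(mulfV (lt0r_neq0 s0)) ler_pM2l.
  set s := Num.sqrt x in s0 se *; set l := - ln _ => sl.
  have : s * (s * l) <= s by rewrite ler_piMr// ltW.
  have -> : s ^+ 2 * (2 * l) = 2 * (s * (s * l)) by ring.
  by move: se; lra.
Unshelve. all: by end_near. Qed.

Lemma cvg_xlnx (f : T -> R) (a : R) : f x @[x --> F] --> a ->
  (f x * ln (f x)) @[x --> F] --> a * ln a.
Proof.
move=> fa.
exact: (@cvg_comp _ _ _ f (fun y => y * ln y) _ _ _ fa (@continuous_xlnx a)).
Qed.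

Lemma cvg_Gfun q (b : R) (P : T -> 'I_q -> R) (p : 'I_q -> R) (f : T -> R * R)
    (m : R * R) :
  (forall k, P x k @[x --> F] --> p k) ->
  (f x).1 @[x --> F] --> m.1 -> (f x).2 @[x --> F] --> m.2 ->
  Gfun b (P x) (f x) @[x --> F] --> Gfun b p m.
Proof.
move=> Pp f1 f2; apply: cvgD; first apply: cvgB.
- by apply: cvgM; [exact: cvg_cst|apply: cvgD; apply: cvgM].
- by apply: cvg_ord_sum => k; apply: cvgM => //; exact: cvg_lnZ.
- by apply: cvg_ord_sum => k; exact: cvg_xlnx.
Qed.

End convergence.

Definition boxset {R : realType} : set (R * R) := `[-1, 1] `*` `[-1, 1].

Lemma boxsetP (R : realType) (m : R * R) : @boxset R m <-> box m.
Proof.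
rewrite /boxset /box /= !in_itv /= !ler_norml; split.
  by case.
by case.
Qed.

Lemma compact_box (R : realType) : compact (@boxset R).
Proof. by apply: compact_setX; exact: segment_compact. Qed.

Definition box_min {R : realType} {q : nat} (b : R) (p : 'I_q -> R)
  (m : R * R) : Prop :=
  box m /\ forall m', box m' -> Gfun b p m <= Gfun b p m'.

Lemma exists_box_min (R : realType) q (b : R) (p : 'I_q -> R) :
  exists m, box_min b p m.
Proof.
have [|||m mB mmin] := @compact_EVT_min _ R (Gfun b p) (@boxset R).
- exists (0, 0); apply/boxsetP; rewrite /box /= normr0; split; exact: ler01.
- exact: compact_box.
- apply: continuous_subspaceT => m; apply: cvg_Gfun => [k||].
  + exact: cvg_cst.
  + exact: cvg_fst.
  + exact: cvg_snd.
exists m; split; first by apply/boxsetP; rewrite inE in mB.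
by move=> m' /boxsetP m'B; apply: mmin; rewrite inE.
Qed.

(* Both G(p, mom g) <= freeE g = G(p, m) - beta/2 |mom g - m|^2 and
   G(p, m) <= G(p, mom g) hold for g = gibbs p m, which forces mom g = m without
   differentiating G. *)
Lemma box_min_gibbs (R : realType) q (b : R) (p : 'I_q -> R) (m : R * R) :
  0 < b -> (0 < q)%N -> simplex R q p -> box_min b p m ->
  mom (gibbs b p m) = m /\ Defs.freeE b (gibbs b p m) = (Gfun b p m)%:E.
Proof.
move=> b0 q0 sp [mB mmin]; have df := density_gibbs b m q0 sp.
have [p0 p1] := sp.
have := freeE_ge b q0 df (fun k => Tproj_gibbs b p m k) p0.
have h := mmin _ (mom_box df).
rewrite freeE_gibbs// lee_fin; set u := mom_cos (gibbs b p m) - m.1.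
set v := mom_sin (gibbs b p m) - m.2 => h'.
have : b / 2 * (u ^+ 2 + v ^+ 2) <= 0.
  move: h h'; move: (Gfun b p m) (Gfun b p _) (b / 2 * _) => A B d; lra.
rewrite pmulr_rle0 ?divr_gt0// => uv.
have u0 : u = 0.
  by apply/eqP; rewrite -sqrf_eq0 eq_le sqr_ge0 andbT (le_trans _ uv)// lerDl sqr_ge0.
have v0 : v = 0.
  by apply/eqP; rewrite -sqrf_eq0 eq_le sqr_ge0 andbT (le_trans _ uv)// lerDr sqr_ge0.
split; last by rewrite u0 v0 expr0n /= addr0 mulr0 subr0.
move/eqP: u0; move/eqP: v0; rewrite !subr_eq0 => /eqP v0 /eqP u0.
by rewrite /mom v0 u0; case: (m).
Qed.

(** The Gibbs density of a box minimiser m attains the conditional minimum, so [xget] returns a true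
    minimiser f. Then G(p, m) <= G(p, mom f) <= freeE f <= G(p, m) forces equality throughout;
    uniqueness of f is never invoked. *)
Lemma nu_of_spec (R : realType) q (b : R) (p : 'I_q -> R) :
  0 < b -> (0 < q)%N -> simplex R q p ->
  box_min b p (mom (nu_of b p)) /\
  Defs.freeE b (nu_of b p) = (Gfun b p (mom (nu_of b p)))%:E.
Proof.
move=> b0 q0 sp; have [p0 _] := sp.
have [m mm] := exists_box_min b p.
have [gm gE] := box_min_gibbs b0 q0 sp mm.
have : is_cond_min b p (nu_of b p).
  apply: xgetPex; exists (gibbs b p m); split; first exact: density_gibbs.
  split=> [k|g dg gp]; first exact: Tproj_gibbs.
  rewrite gE; apply: le_trans (freeE_ge b q0 dg gp p0).
  by rewrite lee_fin; apply: mm.2; exact: mom_box.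
set f := nu_of b p => -[df [fp fmin]].
have h1 := fmin _ (density_gibbs b m q0 sp) (fun k => Tproj_gibbs b p m k).
have h2 := freeE_ge b q0 df fp p0.
rewrite gE in h1.
have h3 := mm.2 _ (mom_box df).
have h4 : Gfun b p (mom f) = Gfun b p m.
  have h21 := le_trans h2 h1; rewrite lee_fin in h21.
  by apply: le_anti; apply/andP; split; [exact: h21|exact: h3].
split; last by apply/eqP; rewrite eq_le h2 andbT h4.
by split=> [|m' m'B]; [exact: mom_box|rewrite h4; exact: mm.2].
Qed.

(** * Dissipation *)

Definition sector_end {R : realType} {q : nat} (k : 'I_q) : R :=
  2 * pi * k.+1%:R / q%:R.

(** A sector starts where its cyclic predecessor ends; for index 0 the two angles are 0 and 2 pi,
    where the weight agrees by periodicity. *)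
Lemma weight_sector_start (R : realType) q (b : R) (m : R * R) (k : 'I_q) :
  weight b m (2 * pi * k%:R / q%:R) = weight b m (sector_end (ord_pred k)).
Proof.
case: k => [[|k] kq]; rewrite /sector_end /=; last first.
  suff -> : ((k.+1 + q).-1 %% q)%N = k by [].
  by rewrite addSn/= addnC modnDl modn_small// ltnW.
rewrite mulr0 mul0r add0n modn_small ?prednK//.
have -> : 2 * pi * q%:R / q%:R = pi *+ 2 :> R.
  by rewrite mulfK ?mulr_natl// pnatr_eq0; case: q kq.
by rewrite /weight /tilt cos0 sin0 cos2pi sin2pi.
Qed.

Lemma sum_ord_pred (R : realType) q (g : 'I_q -> R) :
  \sum_k g (ord_pred k) = \sum_k g k.
Proof. by rewrite [RHS](reindex_inj (@ord_pred_inj q)). Qed.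

(** Differentiating <e_w, m> in w amounts to rotating m by a quarter turn. *)
Lemma is_derive_weight (R : realType) (b : R) (m : R * R) (x : R) :
  is_derive x (1 : R) (weight b m) (weight b m x * tilt b (m.2, - m.1) x).
Proof.
apply: is_derive_eq.
by rewrite /weight /tilt /GRing.scale /=; ring.
Qed.

(* The balance is the component of the mean-field equation along (m.2, -m.1). *)
Lemma rotation_balance (R : realType) q (b : R) (p : 'I_q -> R) (m : R * R) :
  (0 < q)%N -> simplex R q p -> mom (gibbs b p m) = m ->
  \sum_k p k / Zsec b k m * weight b m (sector_end k) =
  \sum_k p k / Zsec b k m * weight b m (sector_end (ord_pred k)).
Proof.
move=> q0 sp fix_m; apply/eqP; rewrite -subr_eq0 -sumrB; apply/eqP.
have df := density_gibbs b m q0 sp.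
have cw : continuous (fun x : R => weight b m x * tilt b (m.2, - m.1) x).
  by move=> x; apply: cvgM; [exact: continuous_weight|exact: continuous_tilt].
(* The boundary values on a sector are the integral of the derivative of the weight over it. *)
have key k : p k / Zsec b k m * weight b m (sector_end k) -
    p k / Zsec b k m * weight b m (sector_end (ord_pred k)) =
    p k / Zsec b k m * Tproj (fun x => weight b m x * tilt b (m.2, - m.1) x) k.
  rewrite -mulrBr -weight_sector_start; congr (_ * _).
  have lt : 2 * pi * k%:R / q%:R < 2 * pi * k.+1%:R / q%:R :> R.
    rewrite ltr_pM2r ?invr_gt0 ?ltr0n// ltr_pM2l ?mulr_gt0 ?pi_gt0//.
    by rewrite ltr_nat.
  have dw := is_derive_weight b m.
  by rewrite /Tproj /sector (Rintegral_derive_itvco lt cw (fun x _ => dw x)).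
rewrite (eq_bigr _ (fun k _ => key k)).
rewrite -(Rintegral_step _ q0); last exact: integrable_circ.
rewrite (@eq_Rint _ _ _ (fun x => gibbs b p m x * tilt b (m.2, - m.1) x)).
  (* The moment of the Gibbs density is m, which is orthogonal to its rotation (m.2, -m.1). *)
  rewrite Rintegral_density_tilt//=.
  have <- : mom_cos (gibbs b p m) = m.1 by rewrite -[in RHS]fix_m.
  have <- : mom_sin (gibbs b p m) = m.2 by rewrite -[in RHS]fix_m.
  by ring.
by move=> x _; rewrite /gibbs; ring.
Qed.

(** The moment m is a separate argument, which makes the expression jointly continuous in (p, m)
    even though [mom (nu_of b p)] is not known to be continuous in p. *)
Definition diss {R : realType} {q : nat} (b : R) (p : 'I_q -> R) (m : R * R) : R :=
  \sum_(k < q) weight b m (sector_end (ord_pred k)) *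
    (Num.sqrt (p k / Zsec b k m) -
     Num.sqrt (p (ord_pred k) / Zsec b (ord_pred k) m)) ^+ 2.

Lemma diss_ge0 (R : realType) q (b : R) (p : 'I_q -> R) (m : R * R) :
  0 <= diss b p m.
Proof.
apply: sumr_ge0 => k _; apply: mulr_ge0; last exact: sqr_ge0.
by rewrite ltW// weight_gt0.
Qed.

Lemma FvecE (R : realType) q (b : R) (p : 'I_q -> R) (k : 'I_q) :
  let m := mom (nu_of b p) in
  Fvec b p k =
    weight b m (sector_end (ord_pred k)) *
      (p (ord_pred k) / Zsec b (ord_pred k) m) -
    weight b m (sector_end k) * (p k / Zsec b k m).
Proof.
have E (x y z : R) : x / y * z = x * (z / y) by rewrite mulrAC mulrA.
by move=> m; congr (_ - _); exact: E.
Qed.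

(** Outflow of a sector is inflow of the next, so the total mass is conserved. *)
Lemma Fvec_sum0 (R : realType) q (b : R) (p : 'I_q -> R) :
  \sum_k Fvec b p k = 0.
Proof.
under eq_bigr do rewrite FvecE.
rewrite sumrB; apply/eqP; rewrite subr_eq0; apply/eqP.
exact: (sum_ord_pred (fun k => weight b _ (sector_end k) * (p k / Zsec b k _))).
Qed.

(* ln x <= 2 (sqrt x - 1), applied to x = s / r *)
Lemma ln_ratio_le (R : realType) (r s : R) : 0 < r -> 0 < s ->
  r * (ln s - ln r) <= s - r - (Num.sqrt s - Num.sqrt r) ^+ 2.
Proof.
move=> r0 s0.
have sr : 0 < Num.sqrt r by rewrite sqrtr_gt0.
have ss : 0 < Num.sqrt s by rewrite sqrtr_gt0.
rewrite -[in X in X <= _](sqr_sqrtr (ltW r0)).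
rewrite -[in X in X <= _](sqr_sqrtr (ltW s0)).
rewrite -[X in _ <= X - _ - _](sqr_sqrtr (ltW s0)).
rewrite -[X in _ <= _ - X - _](sqr_sqrtr (ltW r0)).
move: (Num.sqrt r) (Num.sqrt s) sr ss => x y x0 y0.
rewrite !lnXn// -mulrnBl -ln_div ?posrE//.
have := @le_ln1Dx R (y / x - 1); rewrite addrCA subrr addr0 => h.
have /h {}h : -1 < y / x - 1 by rewrite ltrDr divr_gt0.
have : x ^+ 2 * ln (y / x) <= x ^+ 2 * (y / x - 1) by rewrite ler_pM2l ?exprn_gt0.
have -> : x ^+ 2 * (y / x - 1) = x * y - x ^+ 2 by field; rewrite gt_eqF.
rewrite -mulr_natr mulrA; move: (_ * ln _) => z.
have -> : y ^+ 2 - x ^+ 2 - (y - x) ^+ 2 = 2 * (x * y - x ^+ 2) by ring.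
by lra.
Qed.

Lemma dissipation (R : realType) q (b : R) (p : 'I_q -> R) :
  0 < b -> (0 < q)%N -> simplex R q p -> (forall k, 0 < p k) ->
  \sum_k Fvec b p k * (ln (p k) - ln (Zsec b k (mom (nu_of b p)))) <=
  - diss b p (mom (nu_of b p)).
Proof.
move=> b0 q0 sp p0; set m := mom (nu_of b p); have [mm _] := nu_of_spec b0 q0 sp.
have [fix_m _] := box_min_gibbs b0 q0 sp mm.
have bal := rotation_balance q0 sp fix_m; rewrite -/m in bal.
pose r k := p k / Zsec b k m; pose a (k : 'I_q) := weight b m (sector_end k).
have r0 k : 0 < r k by rewrite divr_gt0 ?Zsec_gt0.
have -> : \sum_k Fvec b p k * (ln (p k) - ln (Zsec b k m)) =
    \sum_k a (ord_pred k) * (r (ord_pred k) * (ln (r k) - ln (r (ord_pred k)))).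
  have -> : \sum_k Fvec b p k * (ln (p k) - ln (Zsec b k m)) =
      \sum_k a (ord_pred k) * r (ord_pred k) * ln (r k) -
      \sum_k a k * r k * ln (r k).
    rewrite -sumrB; apply: eq_bigr => k _.
    by rewrite FvecE -/m -ln_div ?posrE ?Zsec_gt0// -mulrBl.
  rewrite -(sum_ord_pred (fun k => a k * r k * ln (r k))) -sumrB.
  by apply: eq_bigr => k _; ring.
have bal' : \sum_k a (ord_pred k) * (r k - r (ord_pred k)) = 0.
  under eq_bigr do rewrite mulrBr.
  rewrite sumrB (sum_ord_pred (fun k => a k * r k)); apply/eqP.
  rewrite subr_eq0; apply/eqP.
  by under eq_bigr do rewrite mulrC; rewrite -bal; apply: eq_bigr => k _; rewrite mulrC.
(* Adding the zero sum supplied by the balance makes the inequality hold term by term through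
   [ln_ratio_le]. *)
have -> : - diss b p m =
    \sum_k a (ord_pred k) * (r k - r (ord_pred k)) - diss b p m.
  by rewrite bal' add0r.
rewrite /diss -sumrB; apply: ler_sum => k _.
rewrite -mulrBr ler_pM2l ?weight_gt0//.
exact: ln_ratio_le.
Qed.

(** * Decrease along the flow *)

Lemma is_derive_lt0_right (R : realType) (g : R -> R) (c D : R) :
  is_derive c (1 : R) g D -> D < 0 -> \forall s \near c^'+, g s < g c.
Proof.
case=> dg <- D0.
have /(cvgr_lt _) /(_ _ D0) := dg.
rewrite /dnbhs /at_right !near_withinE => h.
have : \forall s \near c, 0 < s - c -> (s - c)^-1 * (g s - g c) < 0.
  have hc : (s - c) @[s --> c] --> (0 : R).
    by rewrite -[X in _ --> X](subrr c); apply: cvgB; [exact: cvg_id|exact: cvg_cst].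
  have h' : \forall s \near c, s - c != 0 ->
      (s - c)^-1 *: (g ((s - c) *: 1 + c) - g c) < 0 by exact: hc h.
  apply: filterS h' => s hs sc; have := hs (lt0r_neq0 sc).
  by rewrite /GRing.scale /= mulr1 subrK.
move=> h'; apply: filterS h' => s hs cs; have sc : 0 < s - c by rewrite subr_gt0.
by have := hs sc; rewrite pmulr_rlt0 ?invr_gt0// subr_lt0.
Qed.

(** Replaces the mean value theorem for a function with no known derivative. A minimum over [a, b]
    attained before b would contradict the strict decrease to its right. *)
Lemma right_decrease_le (R : realType) (W : R -> R) (a b : R) : a <= b ->
  {within `[a, b], continuous W} ->
  (forall c, a <= c < b -> \forall s \near c^'+, W s < W c) -> W b <= W a.
Proof.
move=> ab cW dec; have [c cab cmin] := EVT_min ab cW.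
move: (cab); rewrite in_itv/= => /andP[ac]; rewrite le_eqVlt => /predU1P[cb|cb].
  by rewrite -cb; apply: cmin; rewrite in_itv/= lexx.
have cr : \forall s \near c^'+, s <= b by apply: filterS (nbhs_right_lt cb) => s /ltW.
have : \forall s \near c^'+, False.
  near=> s; have : W s < W c by near: s; apply: dec; rewrite ac.
  have cs : c < s by near: s; exact: nbhs_right_gt.
  rewrite ltNge => /negP; apply; apply: cmin.
  by rewrite in_itv/= (le_trans ac (ltW cs))/=; near: s.
by move/filter_ex => [].
Unshelve. all: by end_near. Qed.

(** By [nu_of_spec] this is the conditional minimum of the free energy as a real number, hence
    [Psi'] up to an additive constant. *)
Definition Vfun {R : realType} {q : nat} (b : R) (p : 'I_q -> R) : R :=
  Gfun b p (mom (nu_of b p)).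

Section value_function.
Context (R : realType) (q : nat) (b : R) (b0 : 0 < b) (q0 : (0 < q)%N).

Lemma Vfun_le (p : 'I_q -> R) m : simplex R q p -> box m ->
  Vfun b p <= Gfun b p m.
Proof. by move=> sp mB; have [[_ h] _] := nu_of_spec b0 q0 sp; exact: h. Qed.

Lemma lnZ_bound (k : 'I_q) m : box m ->
  `|ln (Zsec b k m)| <= `|ln (2 * pi / q%:R : R)| + 2 * b.
Proof.
case=> m1 m2; have := lnZ_lip b k (0, 0) m.
rewrite Zsec0 /= !subr0 => h.
have : `|b| * (`|m.1| + `|m.2|) <= 2 * b.
  rewrite gtr0_norm// mulrC ler_pM2r//.
  by apply: le_trans (lerD m1 m2) _; rewrite -natr1.
have := ler_distD (ln (2 * pi / q%:R)) 0 (ln (Zsec b k m)).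
rewrite !sub0r !normrN => h1 h2.
by apply: le_trans h1 _; rewrite lerD2l; exact: le_trans h h2.
Qed.

(** The minimiser m for p' is a competitor for p. In G(p, m) - G(p', m) the term in |m|^2 cancels
    and ln Z is bounded on the box; exchanging p and p' gives the absolute value. *)
Lemma Vfun_dist (p p' : 'I_q -> R) : simplex R q p -> simplex R q p' ->
  `|Vfun b p - Vfun b p'| <=
  (`|ln (2 * pi / q%:R : R)| + 2 * b) * (\sum_k `|p k - p' k|) +
  `|\sum_k p k * ln (p k) - \sum_k p' k * ln (p' k)|.
Proof.
move: p p'; set C := _ + 2 * b.
suff half p p' : simplex R q p -> simplex R q p' -> Vfun b p - Vfun b p' <=
    C * (\sum_k `|p k - p' k|) +
    `|\sum_k p k * ln (p k) - \sum_k p' k * ln (p' k)|.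
  move=> p p' sp sp'; rewrite ler_norml half// andbT lerNl opprB.
  apply: le_trans (half _ _ sp' sp) _; rewrite distrC lerD2r.
  by under eq_bigr do rewrite distrC.
move=> sp sp'; have [[mB _] _] := nu_of_spec b0 q0 sp'.
have h : Vfun b p - Vfun b p' <= Gfun b p (mom (nu_of b p')) - Vfun b p'.
  by rewrite lerD2r; exact: Vfun_le.
apply: (le_trans h); rewrite /Vfun /Gfun.
set m := mom _ in mB *.
have -> : forall x s s' e e' : R, x - s + e - (x - s' + e') = (s' - s) + (e - e').
  by move=> *; ring.
apply: lerD; last exact: ler_norm.
rewrite -sumrB mulr_sumr; apply: ler_sum => k _.
rewrite -mulrBl; apply: le_trans (ler_norm _) _.
by rewrite normrM distrC mulrC ler_wpM2r//; exact: lnZ_bound.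
Qed.

Lemma cvg_Vfun T (F : set_system T) (FF : Filter F) (P : T -> 'I_q -> R)
    (p : 'I_q -> R) :
  (\forall x \near F, simplex R q (P x)) -> simplex R q p ->
  (forall k, P x k @[x --> F] --> p k) -> Vfun b (P x) @[x --> F] --> Vfun b p.
Proof.
move=> nP sp Pp.
set C := `|ln (2 * pi / q%:R : R)| + 2 * b.
have bnd : (C * (\sum_k `|p k - P x k|) +
    `|\sum_k p k * ln (p k) - \sum_k P x k * ln (P x k)|) @[x --> F] --> (0 : R).
  have E0 : C * (\sum_(k < q) `|p k - p k|) +
      `|\sum_k p k * ln (p k) - \sum_k p k * ln (p k)| = 0.
    rewrite subrr normr0 addr0 big1 ?mulr0// => k _.
    by rewrite subrr normr0.
  rewrite -[X in _ --> X]E0.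
  apply: cvgD.
    apply: cvgM; first exact: cvg_cst.
    apply: (@cvg_ord_sum _ _ F FF q (fun k x => `|p k - P x k|)
      (fun k => `|p k - p k|)) => k; apply: cvg_norm; apply: cvgB; first exact: cvg_cst.
    exact: Pp.
  apply: cvg_norm; apply: cvgB; first exact: cvg_cst.
  apply: (@cvg_ord_sum _ _ F FF q (fun k x => P x k * ln (P x k))
    (fun k => p k * ln (p k))) => k.
  exact: cvg_xlnx.
apply/cvgrPdist_le => e e0.
move/cvgrPdist_le : bnd => /(_ _ e0) bnd.
near=> x.
apply: (le_trans (Vfun_dist _ _)) => //; first by near: x.
rewrite -/C -[leLHS]ger0_norm.
  by rewrite -normrN -[- _]add0r; near: x.
rewrite addr_ge0// mulr_ge0//; last by apply: sumr_ge0.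
by rewrite addr_ge0// mulr_ge0// ltW.
Unshelve. all: by end_near. Qed.

End value_function.

Section flow.
Context (R : realType) (q : nat) (b : R) (b0 : 0 < b) (q0 : (0 < q)%N).
Context (p : 'I_q -> R) (phi : R -> 'I_q -> R) (hphi : is_flow b p phi).

Let sphi (t : R) : 0 <= t -> simplex R q (phi t).
Proof. by have [_ [h _]] := hphi; exact: h. Qed.

Let dphi i (t : R) : 0 < t ->
  is_derive t (1 : R) (fun s => phi s i) (Fvec b (phi t) i).
Proof. by have [_ [_ [_ h]]] := hphi; exact: h. Qed.

Lemma flow_continuous i (t : R) : 0 < t -> phi s i @[s --> t] --> phi t i.
Proof.
move=> t0; have [dt _] := dphi i t0.
have ct : {for t, continuous (fun s => phi s i)}.
  exact/differentiable_continuous/derivable1_diffP.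
exact: ct.
Qed.

Lemma crate_gt0 (k : 'I_q) (p' : 'I_q -> R) : 0 < crate b k p'.
Proof.
apply: divr_gt0; first exact: expR_gt0.
exact: (Zsec_gt0 b k (mom (nu_of b p'))).
Qed.

(* An interior time at which a nonnegative component vanishes is a minimum, so
   the inflow from the preceding sector vanishes there as well. *)
Lemma flow_zero_pred (t : R) k : 0 < t -> phi t k = 0 -> phi t (ord_pred k) = 0.
Proof.
move=> t0 ptk.
have tin : t \in `]0, t + 1[ by rewrite in_itv/= t0 ltrDl ltr01.
have t1 : 0 <= t + 1 by rewrite addr_ge0// ltW.
have d0 : is_derive t (1 : R) (fun s => phi s k) 0.
  apply: (derive1_at_min t1 _ tin) => s; rewrite in_itv/= => /andP[s0 _].
    by case: (dphi k s0).
  by rewrite ptk; case: (sphi (ltW s0)) => + _; exact.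
have := @derive_val _ _ _ _ _ _ _ d0.
rewrite (@derive_val _ _ _ _ _ _ _ (dphi k t0)) /Fvec ptk mulr0 subr0 => /eqP.
by rewrite mulf_eq0 gt_eqF ?crate_gt0//= => /eqP.
Qed.

(** A zero travels backwards to index 0, then to index q - 1, then to every index, against total
    mass 1. Positivity makes the entropy term differentiable for t > 0, even from an initial law
    with empty sectors. *)
Lemma flow_gt0 (t : R) k : 0 < t -> 0 < phi t k.
Proof.
move=> t0; have [p0 p1] := sphi (ltW t0).
rewrite lt_neqAle p0 andbT eq_sym; apply/eqP => ptk.
have down n (i : 'I_q) : phi t i = 0 -> i = n :> nat ->
    forall j : 'I_q, (j <= n)%N -> phi t j = 0.
  elim: n i => [|n IH] i pi0 iE j jn.
    suff -> : j = i by [].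
    by apply/val_inj; rewrite /= iE; apply/eqP; rewrite -leqn0.
  move: jn; rewrite leq_eqVlt => /predU1P[jE|jn].
    by suff -> : j = i by []; apply/val_inj; rewrite /= iE.
  apply: (IH (ord_pred i)) => //; first exact: flow_zero_pred.
  by rewrite /= iE addSn/= addnC modnDl modn_small// ltnW// -iE ltn_ord.
have z0 : phi t (Ordinal q0) = 0 by exact: (down k k).
have all0 j : phi t j = 0.
  apply: (down q.-1 (ord_pred (Ordinal q0))); first exact: flow_zero_pred.
    by rewrite /= add0n modn_small// prednK.
  by rewrite -ltnS prednK.
by move: p1; rewrite big1 => [/eqP|j _]; [rewrite eq_sym oner_eq0|exact: all0].
Qed.

Lemma is_derive_Gfun (t : R) m : 0 < t ->
  is_derive t (1 : R) (fun s => Gfun b (phi s) m)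
    (\sum_k Fvec b (phi t) k * (ln (phi t k) - ln (Zsec b k m))).
Proof.
move=> t0.
pose h k s := phi s k * ln (phi s k) - phi s k * ln (Zsec b k m).
have hE : (fun s => Gfun b (phi s) m) =
    (fun s => b / 2 * (m.1 ^+ 2 + m.2 ^+ 2)) + \sum_k h k.
  apply/funext => s; rewrite /Gfun fct_sumE /h /= -addrA; congr (_ + _).
  by rewrite addrC -sumrB.
have dh k : is_derive t (1 : R) (h k)
    (Fvec b (phi t) k * (ln (phi t k) - ln (Zsec b k m)) + Fvec b (phi t) k).
  have dk := dphi k t0.
  have dl : is_derive t (1 : R) (fun s => ln (phi s k))
      ((phi t k)^-1 * Fvec b (phi t) k).
    apply: (@is_derive1_comp _ (@ln R) (fun s => phi s k)) => //.
    exact/is_derive1_ln/flow_gt0.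
  have d1 := is_deriveM dk dl.
  have d2 := is_deriveM dk (is_derive_cst (ln (Zsec b k m)) t (1 : R)).
  have d3 := is_deriveB d1 d2.
  apply: (is_derive_eq d3).
  rewrite /GRing.scale /= mulr0 add0r mulrA mulfV ?gt_eqF ?flow_gt0//.
  by ring.
rewrite hE.
have d4 := is_deriveD (is_derive_cst (b / 2 * (m.1 ^+ 2 + m.2 ^+ 2)) t (1 : R))
  (is_derive_sum dh).
apply: (is_derive_eq d4).
(* The extra summand from differentiating p ln p is the total flux, which vanishes. *)
by rewrite add0r big_split/= Fvec_sum0 addr0.
Qed.

(** With m frozen at time c, G(phi s, m) lies above V(phi s) and touches it at s = c, so the strict
    decrease of this majorant passes to V. *)
Lemma Vfun_flow_right (d c : R) : 0 < c ->
  d < diss b (phi c) (mom (nu_of b (phi c))) ->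
  \forall s \near c^'+, Vfun b (phi s) + d * s < Vfun b (phi c) + d * c.
Proof.
move=> c0 dc; set m := mom _ in dc.
have sc := sphi (ltW c0); have [[mB _] _] := nu_of_spec b0 q0 sc.
have dG := is_derive_Gfun m c0.
have dd : is_derive c (1 : R) (fun s => d * s) d.
  by apply: is_derive_eq; rewrite /GRing.scale /=; ring.
have := @is_derive_lt0_right _ _ _ _ (is_deriveD dG dd).
have := dissipation b0 q0 sc (fun k => flow_gt0 k c0); rewrite -/m => hd.
have /[swap] /[apply] :
    \sum_k Fvec b (phi c) k * (ln (phi c k) - ln (Zsec b k m)) + d < 0.
  by rewrite -[ltRHS](subrr d) addrC ltrD2l (le_lt_trans hd)// ltrN2.
move=> h; apply: filterS2 (nbhs_right_gt c) h => s cs; apply: le_lt_trans.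
by rewrite lerD2r; apply: Vfun_le => //; apply: sphi; rewrite ltW// (lt_trans c0).
Qed.

(** The differential equation holds only for positive times: the decrease is proved on [a, t] with a
    > 0, and then a tends to 0 by right continuity. The rate d may be negative. *)
Lemma Vfun_flow_decrease (d t : R) : 0 < t ->
  (forall c, 0 < c -> d < diss b (phi c) (mom (nu_of b (phi c)))) ->
  Vfun b (phi t) + d * t <= Vfun b p.
Proof.
move=> t0 hd.
have pE : phi 0 = p by apply/funext => i; have [h _] := hphi; exact: h.
have sp : simplex R q p by rewrite -pE; exact: sphi.
have cV : (Vfun b (phi s) + d * s) @[s --> 0^'+] --> Vfun b p + d * 0.
  apply: cvgD; last first.
    by apply: cvgM; [exact: cvg_cst|exact/cvg_at_right_filter/cvg_id].
  apply: cvg_Vfun => //.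
    by near=> s; apply: sphi; near: s; exact: nbhs_right_ge.
  by have [_ [_ [h _]]] := hphi; exact: h.
rewrite mulr0 addr0 in cV.
apply: (cvgr_to_ge cV); near=> a.
have a0 : 0 < a by near: a; exact: nbhs_right_gt.
have at_ : a <= t by near: a; exact: nbhs_right_le.
apply: (@right_decrease_le _ (fun s => Vfun b (phi s) + d * s)) => //.
  apply: continuous_in_subspaceT => s; rewrite inE/= in_itv/= => /andP[as_ _].
  have s0 := lt_le_trans a0 as_.
  apply: cvgD; last by apply: cvgM; [exact: cvg_cst|exact: cvg_id].
  apply: cvg_Vfun => //; last by move=> k; exact: flow_continuous.
    by near=> u; apply: sphi; apply: ltW; near: u; exact: lt_nbhsr.
  exact/sphi/ltW.
move=> c /andP[ac _]; have c0 := lt_le_trans a0 ac.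
by apply: Vfun_flow_right => //; exact: hd.
Unshelve. all: by end_near. Qed.

End flow.

(** * Bessel functions *)

Lemma continuous_mul (R : realType) (f g : R -> R) :
  continuous f -> continuous g -> continuous (fun x => f x * g x).
Proof. by move=> cf cg x; apply: cvgM; [exact: cf|exact: cg]. Qed.

Lemma continuous_add (R : realType) (f g : R -> R) :
  continuous f -> continuous g -> continuous (fun x => f x + g x).
Proof. by move=> cf cg x; apply: cvgD; [exact: cf|exact: cg]. Qed.

Lemma zero_derive_eq (R : realType) (B : R -> R) (t : R) : 0 <= t ->
  (forall x : R, 0 <= x -> is_derive x (1 : R) B 0) -> B t = B 0.
Proof.
rewrite le_eqVlt => /predU1P[<-//|t0] dB.
have [||c _ /eqP] := @MVT _ B (fun=> 0) _ _ t0.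
- by move=> x; rewrite in_itv/= => /andP[/ltW x0 _]; exact: dB.
- apply: derivable_within_continuous => x; rewrite in_itv/= => /andP[x0 _].
  by case: (dB _ x0).
by rewrite mul0r subr_eq0 => /eqP.
Qed.

(* A(x + 2 pi) - A(x) is constant for an antiderivative A of F. *)
Lemma circ_shift (R : realType) (F : R -> R) (phi : R) : 0 <= phi ->
  continuous F -> (forall x, F (x + 2 * pi) = F x) ->
  Rintegral (leb R) (circ R) (fun w => F (w + phi)) =
  Rintegral (leb R) (circ R) F.
Proof.
move=> phi0 cF Fper.
have pi2 : 0 < 2 * pi :> R by rewrite mulr_gt0 ?pi_gt0.
(* The base point -1 keeps every x >= 0, including 0, away from the lower endpoint, so A has a
   two-sided derivative there. *)
pose A x := Rintegral (leb R) `[-1, x] F.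
have dA (x : R) : 0 <= x -> is_derive x (1 : R) A (F x).
  move=> x0; have xx : x < x + 1 by rewrite ltrDl.
  have x1 : -1 < x by rewrite (lt_le_trans _ x0)// oppr_lt0.
  have Fi : (leb R).-integrable `[-1, x + 1] (EFin \o F).
    exact: (@continuous_integrable_itv _ _ (-1) (x + 1)).
  have [d1 d2] := continuous_FTC1_closed xx Fi x1 (cF x).
  by apply: DeriveDef; [exact: d1|rewrite -derive1E; exact: d2].
have dAs (s x : R) : 0 <= s -> 0 <= x ->
    is_derive x (1 : R) (fun y => A (y + s)) (F (x + s)).
  move=> s0 x0; have ds : is_derive x (1 : R) (fun y => y + s) 1.
    by apply: is_derive_eq; rewrite addr0.
  have := @is_derive1_comp _ A (fun y => y + s) x _ _ (dA _ (addr_ge0 x0 s0)) ds.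
  by rewrite mulr1.
have shift s : 0 <= s -> Rintegral (leb R) (circ R) (fun w => F (w + s)) =
    A (2 * pi + s) - A s.
  move=> s0; have cFs : continuous (fun w => F (w + s)).
    move=> x; apply: (@cvg_comp _ _ _ (fun w => w + s) F _ (nbhs (x + s))).
      by apply: cvgD; [exact: cvg_id|exact: cvg_cst].
    exact: cF.
  have dF x : 0 <= x <= 2 * pi ->
      is_derive x (1 : R) (fun w => A (w + s)) (F (x + s)).
    by move=> /andP[x0 _]; exact: dAs.
  by rewrite /circ (Rintegral_derive_itvco pi2 cFs dF) add0r.
rewrite shift//; have -> : Rintegral (leb R) (circ R) F = A (2 * pi + 0) - A 0.
  by rewrite -shift//; apply: eq_Rint => x _; rewrite addr0.
have key (x : R) : 0 <= x ->
    is_derive x (1 : R) (fun t => A (2 * pi + t) - A t) 0.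
  move=> x0; have d1 : is_derive x (1 : R) (fun t => A (2 * pi + t)) (F (x + 2 * pi)).
    rewrite (_ : (fun t => _) = (fun y => A (y + 2 * pi))); last first.
      by apply/funext => y; rewrite addrC.
    exact: dAs (ltW pi2) x0.
  have := is_deriveB d1 (dA _ x0).
  by rewrite Fper subrr.
exact: (zero_derive_eq phi0 key).
Qed.

Definition ecos {R : realType} (y w : R) : R := expR (y * cos w).

Lemma continuous_ecos (R : realType) (y : R) : continuous (@ecos R y).
Proof.
move=> x; apply: (@cvg_comp _ _ _ (fun w => y * cos w) (@expR R) _ (nbhs (y * cos x))).
  by apply: cvgM; [exact: cvg_cst|exact: continuous_cos].
exact: continuous_expR.
Qed.

Lemma is_derive_ecos_l (R : realType) (y w : R) :
  is_derive y (1 : R) (fun y => ecos y w) (cos w * ecos y w).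
Proof.
by apply: is_derive_eq; rewrite /ecos /GRing.scale /=; ring.
Qed.

Lemma cos_2pi_periodic (R : realType) (x : R) : cos (x + 2 * pi) = cos x.
Proof. by rewrite mulr_natl cosD cos2pi sin2pi mulr1 mulr0 subr0. Qed.

Lemma sin_2pi_periodic (R : realType) (x : R) : sin (x + 2 * pi) = sin x.
Proof. by rewrite mulr_natl sinD cos2pi sin2pi mulr1 mulr0 addr0. Qed.

(* J0 = 2 pi I_0, J1 = 2 pi I_1 for the modified Bessel functions *)
Definition J0 {R : realType} (y : R) : R := Rintegral (leb R) (circ R) (ecos y).
Definition J1 {R : realType} (y : R) : R :=
  Rintegral (leb R) (circ R) (fun w => cos w * ecos y w).
Definition J2 {R : realType} (y : R) : R :=
  Rintegral (leb R) (circ R) (fun w => sin w ^+ 2 * ecos y w).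

Lemma continuous_sin2 (R : realType) : continuous (fun w : R => sin w ^+ 2).
Proof. by apply: continuous_mul; exact: continuous_sin. Qed.

(** Integration by parts of sin w exp(y cos w), whose boundary values vanish at 0 and 2 pi. *)
Lemma J1E (R : realType) (y : R) : J1 y = y * J2 y.
Proof.
have pi2 : 0 < 2 * pi :> R by rewrite mulr_gt0 ?pi_gt0.
have i1 : (leb R).-integrable (circ R) (EFin \o (fun w => cos w * ecos y w)).
  by apply/integrable_circ/continuous_mul; [exact: continuous_cos|exact: continuous_ecos].
have c2 : continuous (fun w => sin w ^+ 2 * ecos y w).
  by apply: continuous_mul; [exact: continuous_sin2|exact: continuous_ecos].
have i2 := integrable_circ c2.
have mC := @measurable_circ R.
apply/eqP; rewrite -subr_eq0 /J1 /J2 -(RintZ mC)// -(RintB mC)//; last first.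
  exact: integrable_RZ.
have cd : continuous (fun w => cos w * ecos y w - y * (sin w ^+ 2 * ecos y w)).
  move=> x; apply: cvgB.
    by apply: cvgM; [exact: continuous_cos|exact: continuous_ecos].
  by apply: cvgM; [exact: cvg_cst|exact: c2].
have dd x : 0 <= x <= 2 * pi -> is_derive x (1 : R) (fun w => sin w * ecos y w)
    (cos x * ecos y x - y * (sin x ^+ 2 * ecos y x)).
  move=> _; apply: is_derive_eq.
  by rewrite /ecos /GRing.scale /=; ring.
by rewrite /circ (Rintegral_derive_itvco pi2 cd dd) mulr_natl sin2pi sin0 !mul0r subrr.
Qed.

Lemma is_derive_J0 (R : realType) (y : R) : is_derive y (1 : R) J0 (J1 y).
Proof.
have mC := @measurable_circ R.
(* exp M dominates the integrand's derivative for all parameters within 1 of y. *)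
pose M := `|y| + 1.
have Iy : `]y - 1, y + 1[%classic y by rewrite /= in_itv/= ltrBlDr ltrDl ltr01.
have fi x : `]y - 1, y + 1[%classic x ->
    (leb R).-integrable (circ R) (EFin \o @ecos R x).
  by move=> _; exact/integrable_circ/continuous_ecos.
have df x w : `]y - 1, y + 1[%classic x -> circ R w ->
    derivable (fun x => ecos x w) x 1.
  by move=> _ _; case: (is_derive_ecos_l x w).
have G0 (w : R) : 0 <= (fun=> expR M : R) w by exact: expR_ge0.
have Gi : (leb R).-integrable (circ R) (EFin \o (fun=> expR M : R)).
  by apply: integrable_circ => x; exact: cvg_cst.
have dE x w : partial1of2 (@ecos R) x w = cos w * ecos x w.
  by rewrite partial1of2E; case: (is_derive_ecos_l x w).
have Gub x w : `]y - 1, y + 1[%classic x -> circ R w ->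
    `|partial1of2 (@ecos R) x w| <= (fun=> expR M : R) w.
  rewrite /= in_itv/= => /andP[x1 x2] _; rewrite dE normrM.
  have c1 : `|cos w| <= 1 by rewrite ler_norml cos_geN1 cos_le1.
  rewrite -[leRHS]mul1r; apply: ler_pM => //.
  rewrite ger0_norm ?expR_ge0// ler_expR (le_trans (ler_norm _))//.
  rewrite normrM (@le_trans _ _ `|x|)//; first by rewrite ler_piMr.
  rewrite /M -lerBlDl (le_trans (lerB_dist _ _))//.
  by rewrite ler_norml; apply/andP; split; [rewrite lerBrDl ltW|rewrite lerBlDl ltW].
apply: DeriveDef.
  by apply: (derivable_under_integral _ Iy fi df G0 Gi Gub); exact: mC.
rewrite -derive1E.
have := differentiation_under_integral _ Iy fi df G0 Gi Gub.
move=> -> //; apply: eq_Rint => w _; exact: dE.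
Qed.

(** Twice the hyperbolic cosine of a u. *)
Definition ch {R : realType} (a u : R) : R := expR (a * u) + expR (- (a * u)).

Lemma ch_gt0 (R : realType) (a u : R) : 0 < ch a u.
Proof. by rewrite addr_gt0// expR_gt0. Qed.

Lemma ch_norm (R : realType) (a u : R) : ch a `|u| = ch a u.
Proof.
have [u0|u0] := ger0P u; first by [].
by rewrite /ch mulrN opprK addrC.
Qed.

Lemma ch1_mono (R : realType) (x y : R) : `|x| <= `|y| -> ch 1 x <= ch 1 y.
Proof.
rewrite -(ch_norm _ x) -(ch_norm _ y); move: `|x| (normr_ge0 x) `|y| => s s0 t st.
rewrite /ch !mul1r !expRN.
have X1 : 1 <= expR s by rewrite -expR0 ler_expR.
have XY : expR s <= expR t by rewrite ler_expR.
move: (expR s) (expR t) X1 XY => X Y X1 XY.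
have X0 : 0 < X by exact: lt_le_trans X1.
have Y0 : 0 < Y by exact: lt_le_trans XY.
rewrite -subr_ge0.
have -> : Y + Y^-1 - (X + X^-1) = (Y - X) * (X * Y - 1) / (X * Y).
  by field; rewrite !gt_eqF.
apply: divr_ge0; last by rewrite mulr_ge0// ltW.
apply: mulr_ge0; rewrite subr_ge0//.
by apply: mulr_ege1 => //; exact: le_trans X1 XY.
Qed.

Lemma ch_mul (R : realType) (a b u v : R) :
  ch a u * ch b v = ch 1 (a * u + b * v) + ch 1 (a * u - b * v).
Proof. by rewrite /ch !mul1r !opprD !opprK !expRD; ring. Qed.

(** Says that cosh(a u) / cosh(b u) grows with |u|. The product formula reduces it to b u + a v <= a
    u + b v and |b u - a v| <= a u - b v. *)
Lemma ch_cross (R : realType) (a b u v : R) : 0 <= b -> b <= a -> `|v| <= `|u| ->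
  ch b u * ch a v <= ch a u * ch b v.
Proof.
rewrite -(ch_norm a u) -(ch_norm b u) -(ch_norm a v) -(ch_norm b v).
move: `|v| (normr_ge0 v) `|u| => {u v} v v0 u b0 ba vu.
have u0 := le_trans v0 vu; have a0 := le_trans b0 ba.
have h1 : 0 <= (a - b) * (u - v) by rewrite mulr_ge0// subr_ge0.
have h2 : 0 <= (a - b) * (u + v) by rewrite mulr_ge0 ?subr_ge0// addr_ge0.
have h3 : 0 <= (a + b) * (u - v) by rewrite mulr_ge0 ?subr_ge0// addr_ge0.
have bu := mulr_ge0 b0 u0; have av := mulr_ge0 a0 v0.
have au := mulr_ge0 a0 u0; have bv := mulr_ge0 b0 v0.
rewrite !ch_mul; apply: lerD; apply: ch1_mono.
  rewrite !ger0_norm ?addr_ge0//.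
  by move: h1; rewrite mulrBl !mulrBr; lra.
rewrite [leRHS]ger0_norm; last first.
  by move: h2 h3; rewrite !(mulrBl, mulrDl, mulrBr, mulrDr); lra.
rewrite ler_norml; move: h2 h3; rewrite !(mulrBl, mulrDl, mulrBr, mulrDr) => h2 h3.
by apply/andP; split; lra.
Qed.

Section bessel.
Context (R : realType) (h y0 : R) (h1 : h <= 1) (y00 : 0 < y0)
  (hJ : J2 y0 = h * J0 y0).
Let mC := @measurable_circ R.

Let cg y : continuous (fun w : R => (sin w ^+ 2 - h) * ecos y w).
Proof.
apply: continuous_mul; last exact: continuous_ecos.
by apply: continuous_add; [exact: continuous_sin2|exact: cst_continuous].
Qed.

Let Kch y := Rintegral (leb R) (circ R)
  (fun w => (sin w ^+ 2 - h) * ch y (cos w)).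

(** The shift w -> w + pi changes the sign of cos w and preserves sin^2 w, so both exponentials of
    [ch] have the same integral. *)
Lemma KchE y : Kch y = 2 * (J2 y - h * J0 y).
Proof.
have ii y' := integrable_circ (@cg y').
have i0 y' := integrable_circ (@continuous_ecos R y').
have i2 : (leb R).-integrable (circ R) (EFin \o (fun w => sin w ^+ 2 * ecos y w)).
  apply/integrable_circ/continuous_mul; first exact: continuous_sin2.
    exact: continuous_ecos.
have E : Rintegral (leb R) (circ R) (fun w => (sin w ^+ 2 - h) * ecos y w) =
    J2 y - h * J0 y.
  rewrite /J2 /J0 -(RintZ mC)// -(RintB mC)//; last exact: integrable_RZ.
  by apply: eq_Rint => w _; rewrite mulrBl.
have E' : Rintegral (leb R) (circ R) (fun w => (sin w ^+ 2 - h) * ecos (- y) w) =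
    J2 y - h * J0 y.
  rewrite -E -(circ_shift (pi_ge0 R) (@cg y)); last first.
    by move=> x; rewrite /ecos cos_2pi_periodic sin_2pi_periodic.
  apply: eq_Rint => w _; rewrite /ecos cosDpi sinDpi sqrrN mulrN mulNr.
  by [].
rewrite mulr2n mulrDl mul1r -{1}E -E' -(RintD mC)//.
by apply: eq_Rint => w _; rewrite /ch /ecos mulNr; ring.
Qed.

(* The sign changes of sin^2 - h and of the ratio of the two hyperbolic cosines
   occur at the same value of |cos w|. *)
Lemma J2_cross (y z : R) : 0 <= y -> y <= z ->
  (J2 y = h * J0 y -> J2 z <= h * J0 z) /\ (J2 z = h * J0 z -> h * J0 y <= J2 y).
Proof.
(* With this u, sin^2 w - h = u^2 - cos^2 w changes sign at |cos w| = u. *)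
move=> y_ge0 yz; pose u := Num.sqrt (1 - h).
have u2 : u ^+ 2 = 1 - h by rewrite sqr_sqrtr// subr_ge0.
have u0 : 0 <= u by exact: sqrtr_ge0.
have ic x : (leb R).-integrable (circ R)
    (EFin \o (fun w => (sin w ^+ 2 - h) * ch x (cos w))).
  rewrite (_ : _ \o _ = EFin \o (fun w => (sin w ^+ 2 - h) * ecos x w +
      (sin w ^+ 2 - h) * ecos (- x) w)).
    by apply: (integrable_RD mC); exact: integrable_circ.
  by apply/funext => w /=; congr _%:E; rewrite /ch /ecos mulNr mulrDr.
(* Holds pointwise: by [ch_cross] the difference of the products of [ch] has sign opposite to u^2 -
   cos^2 w in both cases. *)
have key : Kch z * ch y u <= Kch y * ch z u.
  rewrite mulrC [leRHS]mulrC -!(RintZ mC)//.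
  apply: (le_Rint mC).
  - exact: (integrable_RZ mC _ (ic z)).
  - exact: (integrable_RZ mC _ (ic y)).
  move=> w _; rewrite mulrCA [leRHS]mulrCA.
  have sc : sin w ^+ 2 - h = u ^+ 2 - cos w ^+ 2.
    by rewrite u2; have := cos2Dsin2 w => <-; ring.
  rewrite sc; have [uc|/ltW cu] := leP u `|cos w|.
    have : `|u| <= `|cos w| by rewrite ger0_norm.
    move=> /(ch_cross y_ge0 yz) hc.
    apply: ler_wnM2l; last by rewrite mulrC [leRHS]mulrC.
    by rewrite subr_le0 -[leRHS]real_normK ?num_real// ler_sqr ?nnegrE.
  have : `|cos w| <= `|u| by rewrite (ger0_norm u0).
  move=> /(ch_cross y_ge0 yz) hc.
  apply: ler_wpM2l => //.
  by rewrite subr_ge0 -[leLHS]real_normK ?num_real// ler_sqr ?nnegrE.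
rewrite !KchE in key; split=> E; move: key; rewrite E subrr mulr0 mul0r.
  by rewrite pmulr_lle0 ?ch_gt0// pmulr_rle0// subr_le0.
by rewrite pmulr_lge0 ?ch_gt0// pmulr_rge0// subr_ge0.
Qed.

Let N y := expR (- (h / 2 * y ^+ 2)) * J0 y.

Let dN y : is_derive y (1 : R) N
  (expR (- (h / 2 * y ^+ 2)) * (y * (J2 y - h * J0 y))).
Proof.
have d1 : is_derive y (1 : R) (fun y => expR (- (h / 2 * y ^+ 2)))
    (expR (- (h / 2 * y ^+ 2)) * (- (h * y))).
  by apply: is_derive_eq; rewrite /GRing.scale /=; field.
have d2 := is_deriveM d1 (is_derive_J0 y).
apply: (is_derive_eq d2); rewrite J1E /GRing.scale /=; ring.
Qed.

(** The derivative of [N] has the sign of J2 - h J0 on y > 0, nonnegative before y0 and nonpositive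
    after it by [J2_cross]. For h = 1/b and y = b rho, - ln N is the mean-field free energy at
    radius rho. *)
Lemma J0_max (y : R) : 0 <= y ->
  expR (- (h / 2 * y ^+ 2)) * J0 y <= expR (- (h / 2 * y0 ^+ 2)) * J0 y0.
Proof.
move=> yge0; rewrite -/(N y) -/(N y0).
have cN u v : {within `[u, v], continuous N}.
  by apply: derivable_within_continuous => x _; case: (dN x).
have [yy|yy|-> //] := ltgtP y y0.
  have [|c] := @MVT _ N _ _ _ yy (fun x _ => dN x); first exact: cN.
  rewrite in_itv/= => /andP[yc cy0] E; rewrite -subr_ge0 E.
  have c0 : 0 <= c by rewrite (le_trans yge0)// ltW.
  rewrite !mulr_ge0 ?expR_ge0 ?subr_ge0 ?(ltW yy)//.
  by have [_] := J2_cross c0 (ltW cy0); apply.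
have [|c] := @MVT _ N _ _ _ yy (fun x _ => dN x); first exact: cN.
rewrite in_itv/= => /andP[y0c cy] E; rewrite -subr_le0 E.
have c0 : 0 <= c by rewrite (le_trans (ltW y00))// ltW.
rewrite pmulr_lle0 ?subr_gt0// pmulr_rle0 ?expR_gt0//.
rewrite mulr_ge0_le0// subr_le0.
by have [+ _] := J2_cross (ltW y00) (ltW y0c); apply.
Qed.

End bessel.

(** * Critical points *)

Definition Ztot {R : realType} (b : R) (m : R * R) : R :=
  Rintegral (leb R) (circ R) (weight b m).

(** The sign in m.2 makes the tilt a multiple of cos (w + phi), and phi >= 0 is what [circ_shift]
    requires; hence 2 pi - acos when m.2 > 0. *)
Lemma polar (R : realType) (m : R * R) : exists rho phi : R,
  [/\ 0 <= rho, 0 <= phi, m.1 = rho * cos phi, m.2 = - (rho * sin phi) &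
      m.1 ^+ 2 + m.2 ^+ 2 = rho ^+ 2].
Proof.
case: m => x y /=; pose rho := Num.sqrt (x ^+ 2 + y ^+ 2).
have s0 : 0 <= x ^+ 2 + y ^+ 2 by rewrite addr_ge0 ?sqr_ge0.
have rho2 : rho ^+ 2 = x ^+ 2 + y ^+ 2 by rewrite sqr_sqrtr.
have rho0 : 0 <= rho by exact: sqrtr_ge0.
have [r0|rn0] := eqVneq rho 0.
  have /eqP : x ^+ 2 + y ^+ 2 = 0 by rewrite -rho2 r0 expr0n.
  rewrite paddr_eq0 ?sqr_ge0// !sqrf_eq0 => /andP[/eqP -> /eqP ->].
  by exists 0, 0; rewrite !mul0r oppr0 expr0n /= addr0; split.
have rgt0 : 0 < rho by rewrite lt_neqAle eq_sym rn0.
pose c := x / rho.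
have xE : x = rho * c by rewrite /c mulrCA mulfV// mulr1.
have c2 : c ^+ 2 + (y / rho) ^+ 2 = 1.
  by rewrite !expr_div_n -mulrDl -rho2 mulfV// sqrf_eq0.
have c1 : -1 <= c <= 1.
  rewrite -ler_norml -(@ler_pXn2r _ 2) ?nnegrE// expr1n real_normK ?num_real//.
  by rewrite -c2 lerDl sqr_ge0.
have cK : cos (acos c) = c by rewrite acosK// in_itv/=.
have sE : rho * sin (acos c) = `|y|.
  rewrite sin_acos//; have -> : 1 - c ^+ 2 = (y / rho) ^+ 2 by rewrite -c2 addrC addKr.
  by rewrite sqrtr_sqr normrM normfV (gtr0_norm rgt0) mulrCA mulfV// mulr1.
have [y0|y0] := leP y 0.
  exists rho, (acos c); split => //; first exact: acos_ge0.
    by rewrite cK.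
  by rewrite sE ler0_norm// opprK.
exists rho, (pi *+ 2 - acos c); split => //.
- rewrite subr_ge0 (le_trans (acos_lepi c1))// mulr2n lerDl; exact: pi_ge0.
- by rewrite cosB cos2pi sin2pi mul1r mul0r addr0 cK.
- by rewrite sinB cos2pi sin2pi mul1r mul0r add0r mulrN opprK sE gtr0_norm.
Qed.

Section polar_integrals.
Context (R : realType) (b rho phi : R) (m : R * R) (phi0 : 0 <= phi)
  (m1 : m.1 = rho * cos phi) (m2 : m.2 = - (rho * sin phi)).

Lemma tilt_polar (w : R) : tilt b m w = b * rho * cos (w + phi).
Proof. by rewrite /tilt m1 m2 cosD; ring. Qed.

Lemma Ztot_polar : Ztot b m = J0 (b * rho).
Proof.
rewrite /J0 -(circ_shift phi0 (@continuous_ecos _ _)).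
  by apply: eq_Rint => w _; rewrite /weight tilt_polar.
by move=> x; rewrite /ecos cos_2pi_periodic.
Qed.

Lemma weight_tilt_polar :
  Rintegral (leb R) (circ R) (fun w => weight b m w * tilt b m w) =
  b * rho * J1 (b * rho).
Proof.
have cc : continuous (fun w : R => cos w * ecos (b * rho) w).
  by apply: continuous_mul; [exact: continuous_cos|exact: continuous_ecos].
rewrite /J1 -(circ_shift phi0 cc); last first.
  by move=> x; rewrite /ecos cos_2pi_periodic.
have ccs : continuous (fun w : R => cos (w + phi) * ecos (b * rho) (w + phi)).
  move=> x; apply: (@cvg_comp _ _ _ (fun w => w + phi)
      (fun w : R => cos w * ecos (b * rho) w) _ (nbhs (x + phi))).
    by apply: cvgD; [exact: cvg_id|exact: cvg_cst].
  exact: cc.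
rewrite -(RintZ (@measurable_circ R))//; last exact: integrable_circ.
by apply: eq_Rint => w _; rewrite /weight tilt_polar /ecos; ring.
Qed.

End polar_integrals.

Lemma Ztot_gt0 (R : realType) (b : R) (m : R * R) : 0 < Ztot b m.
Proof.
rewrite /Ztot (@Rintegral_circ_sectors R 1)//; last first.
  exact/integrable_circ/continuous_weight.
by rewrite big_ord1; exact: Zsec_gt0.
Qed.

Lemma Ztot_sum (R : realType) q (b : R) (m : R * R) : (0 < q)%N ->
  Ztot b m = \sum_(k < q) Zsec b k m.
Proof.
move=> q0; rewrite /Ztot (Rintegral_circ_sectors q0)//.
exact/integrable_circ/continuous_weight.
Qed.

(** Nonnegativity of the entropy of p relative to the law Z_k / Z, via the tangent inequality in
    each sector. *)
Lemma Gfun_ge_Ztot (R : realType) q (b : R) (p : 'I_q -> R) (m : R * R) :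
  (0 < q)%N -> simplex R q p ->
  b / 2 * (m.1 ^+ 2 + m.2 ^+ 2) - ln (Ztot b m) <= Gfun b p m.
Proof.
move=> q0 [p0 p1]; rewrite /Gfun -addrA lerD2l.
have Z0 := Ztot_gt0 b m.
rewrite addrC -sumrB.
have -> : - ln (Ztot b m) =
    \sum_k (- (p k * ln (Ztot b m)) + p k - Zsec b k m / Ztot b m).
  rewrite !big_split/= !sumrN -mulr_suml p1 mul1r -mulr_suml -Ztot_sum//.
  by rewrite mulfV ?gt_eqF//; ring.
apply: ler_sum => k _.
move: (Ztot b m) Z0 (Zsec b k m) (Zsec_gt0 b k m) => Z Z0 z z0.
have := xlnx_tangent (p0 k) (divr_gt0 z0 Z0); rewrite ln_div//.
by move: (ln (p k)) (ln z) (ln Z) (z / Z) => x y u s; lra.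
Qed.

Lemma Gfun_proportional (R : realType) q (b r : R) (p : 'I_q -> R) (m : R * R) :
  (0 < q)%N -> simplex R q p -> (forall k, p k = r * Zsec b k m) ->
  r = (Ztot b m)^-1 /\
  Gfun b p m = b / 2 * (m.1 ^+ 2 + m.2 ^+ 2) - ln (Ztot b m).
Proof.
move=> q0 [p0 p1] pr; have Z0 := Ztot_gt0 b m.
have rE : r = (Ztot b m)^-1.
  apply: (mulIf (lt0r_neq0 Z0)); rewrite mulVf ?gt_eqF//.
  by rewrite (Ztot_sum _ _ q0) mulr_sumr -p1; apply: eq_bigr => k _; rewrite pr.
split=> //; rewrite /Gfun -addrA; congr (_ + _).
rewrite addrC -sumrB -[X in - X]mul1r -p1 mulr_suml -sumrN.
apply: eq_bigr => k _.
have r0 : 0 < r by rewrite rE invr_gt0.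
have -> : ln (p k) = ln r + ln (Zsec b k m).
  by rewrite pr lnM ?posrE ?Zsec_gt0.
by rewrite rE lnV ?posrE//; ring.
Qed.

(** Pairing the mean-field equation with m gives b |m|^2 Z = y0 J1(y0) for y0 = b |m|, hence J2(y0)
    = J0(y0) / b by [J1E]. So y0 is a positive critical point and [J0_max] compares it with every
    other radius. *)
Lemma radial_min (R : realType) q (b r : R) (p : 'I_q -> R) (m m' : R * R) :
  0 < b -> (0 < q)%N -> simplex R q p -> (forall k, p k = r * Zsec b k m) ->
  mom (gibbs b p m) = m -> m <> (0, 0) ->
  b / 2 * (m.1 ^+ 2 + m.2 ^+ 2) - ln (Ztot b m) <=
  b / 2 * (m'.1 ^+ 2 + m'.2 ^+ 2) - ln (Ztot b m').
Proof.
move=> b0 q0 sp pr fix_m m0.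
have [rE _] := Gfun_proportional q0 sp pr.
have [rho [phi [rho0 phi0 m1 m2 mE]]] := polar m.
have [rho' [phi' [rho0' phi0' m1' m2' mE']]] := polar m'.
have mC := @measurable_circ R.
have rho_gt0 : 0 < rho.
  rewrite lt_neqAle rho0 andbT eq_sym; apply/eqP => r0; apply: m0.
  by move: m1 m2; rewrite r0 !mul0r oppr0; case: (m) => x y /= -> ->.
pose y0 := b * rho; have y00 : 0 < y0 by rewrite mulr_gt0.
have wt : continuous (fun w => weight b m w * tilt b m w).
  by apply: continuous_mul; [exact: continuous_weight|exact: continuous_tilt].
have E : b * (m.1 ^+ 2 + m.2 ^+ 2) = r * (y0 * J1 y0).
  rewrite -(weight_tilt_polar b phi0 m1 m2) -(RintZ mC)//; last exact: integrable_circ.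
  have := Rintegral_density_tilt b m (density_gibbs b m q0 sp).
  have -> : mom_cos (gibbs b p m) = m.1 by rewrite -[in RHS]fix_m.
  have -> : mom_sin (gibbs b p m) = m.2 by rewrite -[in RHS]fix_m.
  rewrite -!expr2 => <-; apply: eq_Rint => w wc.
  have [k kw] := circ_sector q0 wc.
  by rewrite /gibbs (stepE _ kw) pr mulfK ?gt_eqF ?Zsec_gt0//; ring.
have J00 : 0 < J0 y0 by rewrite -(Ztot_polar b phi0 m1 m2) Ztot_gt0.
have J2E : J2 y0 = b^-1 * J0 y0.
  move: E; rewrite mE rE (Ztot_polar b phi0 m1 m2) -/y0 J1E => E.
  have : b * rho ^+ 2 * J0 y0 = y0 * (y0 * J2 y0).
    by rewrite E; field; rewrite gt_eqF.
  rewrite /y0 => E'; apply: (mulfI (lt0r_neq0 b0)).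
  apply: (mulfI (lt0r_neq0 b0)); apply: (mulfI (lt0r_neq0 rho_gt0)).
  apply: (mulfI (lt0r_neq0 rho_gt0)).
  transitivity (b * rho * (b * rho * J2 (b * rho))); first by ring.
  by rewrite -E'; field; rewrite gt_eqF.
(* The critical equation itself gives this, as sin^2 <= 1 makes J2 <= J0. *)
have b1 : b^-1 <= 1.
  rewrite -(ler_pM2r J00) mul1r -J2E; apply: (le_Rint mC).
  - apply/integrable_circ/continuous_mul; first exact: continuous_sin2.
    exact: continuous_ecos.
  - exact/integrable_circ/continuous_ecos.
  move=> w _; apply: ler_piMl; first exact: expR_ge0.
  by rewrite -(cos2Dsin2 w) lerDr sqr_ge0.
have y0' : 0 <= b * rho' by rewrite mulr_ge0// ltW.
have := J0_max b1 y00 J2E y0'.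
rewrite -(Ztot_polar b phi0 m1 m2) -(Ztot_polar b phi0' m1' m2').
move: (Ztot b m) (Ztot_gt0 b m) (Ztot b m') (Ztot_gt0 b m') => z z0 z' z0'.
rewrite -ler_ln ?posrE ?mulr_gt0 ?expR_gt0//.
rewrite !lnM ?posrE ?expR_gt0// !expRK mE mE' /y0.
have sq s : b^-1 / 2 * (b * s) ^+ 2 = b / 2 * s ^+ 2 by field; rewrite gt_eqF.
rewrite !sq; move: (ln _) (ln _) (_ * _) (_ * _) => x y u v; lra.
Qed.

Lemma ord_pred_val q (k : 'I_q) : (0 < k)%N -> ord_pred k = k.-1 :> nat.
Proof.
move=> k0 /=; have -> : ((k + q).-1 = k.-1 + q)%N by rewrite -{1}(prednK k0).
by rewrite modnDr modn_small// (leq_ltn_trans (leq_pred k)).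
Qed.

(** All terms vanish and the weights are positive, so p k / Z_k equals its predecessor; descent to
    index 0 makes it constant. *)
Lemma diss_eq0 (R : realType) q (b : R) (p : 'I_q -> R) (m : R * R) :
  (0 < q)%N -> simplex R q p -> diss b p m = 0 ->
  exists r, forall k, p k = r * Zsec b k m.
Proof.
move=> q0 [p0 p1] d0.
pose r k := p k / Zsec b k m.
have r0 k : 0 <= r k by rewrite divr_ge0// ltW// Zsec_gt0.
have step1 k : r k = r (ord_pred k).
  have /eqP : weight b m (sector_end (ord_pred k)) *
      (Num.sqrt (r k) - Num.sqrt (r (ord_pred k))) ^+ 2 = 0.
    apply: (psumr_eq0P _ d0) => // i _; apply: mulr_ge0; last exact: sqr_ge0.
    by rewrite ltW// weight_gt0.
  rewrite mulf_eq0 gt_eqF ?weight_gt0//= sqrf_eq0 subr_eq0 eqr_sqrt//.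
  by move/eqP.
exists (r (Ordinal q0)) => k.
suff -> : r (Ordinal q0) = r k by rewrite /r divfK// gt_eqF// Zsec_gt0.
have [n nk] := ubnP (nat_of_ord k); move: k nk.
elim: n => // n IH k kn.
have [k0|k0] := posnP (nat_of_ord k); first by congr r; apply/val_inj; rewrite /= k0.
rewrite [RHS]step1; apply: IH; rewrite ord_pred_val//.
by rewrite -ltnS prednK.
Qed.

(** * Compactness and conclusion *)

Lemma cvg_diss (R : realType) (T : Type) (F : set_system T) (FF : Filter F) q
    (b : R) (P : T -> 'I_q -> R) (p : 'I_q -> R) (f : T -> R * R) (m : R * R) :
  (forall k, P x k @[x --> F] --> p k) ->
  (f x).1 @[x --> F] --> m.1 -> (f x).2 @[x --> F] --> m.2 ->
  diss b (P x) (f x) @[x --> F] --> diss b p m.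
Proof.
move=> Pp f1 f2.
have cr k : Num.sqrt (P x k / Zsec b k (f x)) @[x --> F] -->
    Num.sqrt (p k / Zsec b k m).
  apply: (@cvg_comp _ _ _ (fun x => P x k / Zsec b k (f x)) (@Num.sqrt R) _
    (nbhs (p k / Zsec b k m))); last exact: sqrt_continuous.
  apply: cvgM => //; apply: cvgV; first by rewrite gt_eqF// Zsec_gt0.
  rewrite -[X in _ --> X](lnK (Zsec_gt0 b k m)).
  under eq_fun do rewrite -[Zsec _ _ _](lnK (Zsec_gt0 b k _)).
  apply: (@cvg_comp _ _ _ (fun x => ln (Zsec b k (f x))) (@expR R) _
    (nbhs (ln (Zsec b k m)))); last exact: continuous_expR.
  exact: cvg_lnZ.
apply: (@cvg_ord_sum _ _ F FF q (fun k x =>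
  weight b (f x) (sector_end (ord_pred k)) *
    (Num.sqrt (P x k / Zsec b k (f x)) -
     Num.sqrt (P x (ord_pred k) / Zsec b (ord_pred k) (f x))) ^+ 2)) => k.
have cd := cvgB (cr k) (cr (ord_pred k)).
apply: cvgM; last exact: (cvgM (cd FF) (cd FF)).
apply: (@cvg_comp _ _ _ (fun x => tilt b (f x) (sector_end (ord_pred k)))
  (@expR R) _ (nbhs (tilt b m (sector_end (ord_pred k))))).
  apply: cvgM; first exact: cvg_cst.
  by apply: cvgD; apply: cvgM => //; exact: cvg_cst.
exact: continuous_expR.
Qed.

Section sublevel.
Context (R : realType) (q : nat) (b : R) (b0 : 0 < b) (q0 : (0 < q)%N)
  (U : set ('I_q -> R)) (hU : rel_open U) (v : R).

(** Laws are stored as row vectors so that compactness of the cube comes from [rV_compact]. *)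
Let coord (z : 'rV[R]_q * (R * R)) : 'I_q -> R := fun k => z.1 ord0 k.

(* Points are pairs (p, m) with m a minimiser for p; minimality is a closed
   condition, so no continuous selection of m is needed. *)
Definition bad_set : set ('rV[R]_q * (R * R)) :=
  [set z | [/\ simplex R q (coord z), ~ U (coord z), box_min b (coord z) z.2 &
    Gfun b (coord z) z.2 <= v]].

Lemma compact_bad_set : compact bad_set.
Proof.
pose A := [set w : 'rV[R]_q | forall k, `[0, 1]%classic (w ord0 k)].
apply: (@subclosed_compact _ _ (A `*` boxset)); last 2 first.
- apply: compact_setX; last exact: compact_box.
  exact: (@rV_compact R q (fun=> `[0, 1]%classic) (fun=> @segment_compact _ 0 1)).
- move=> [w m] [[p0 p1] _ [mB _] _]; split; last exact/boxsetP.
  move=> k; rewrite /= in_itv/= p0 /= -p1 (bigD1 k)//= lerDl.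
  by apply: sumr_ge0 => i _; exact: p0.
(* Closedness: every defining condition passes to the limit along a filter converging to z; for the
   complement of U this is relative openness. *)
move=> z; rewrite closureEcvg => -[F FF [Fz KF]].
have nK : \forall x \near F, bad_set x by apply: KF.
have c1 k : coord x k @[x --> F] --> coord z k.
  apply: (@cvg_comp _ _ _ (fun x : 'rV[R]_q * (R * R) => x.1)
    (fun w : 'rV[R]_q => w ord0 k) _ (nbhs z.1)); last exact: coord_continuous.
  by apply: cvg_trans (@cvg_fst _ _ (nbhs z.1) (nbhs z.2) _); apply: cvg_app.
have c2 : x.2 @[x --> F] --> z.2.
  by apply: cvg_trans (@cvg_snd _ _ (nbhs z.1) (nbhs z.2) _); apply: cvg_app.
have c21 : x.2.1 @[x --> F] --> z.2.1.
  by apply: cvg_trans (@cvg_fst _ _ (nbhs z.2.1) (nbhs z.2.2) _); apply: (cvg_app fst c2).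
have c22 : x.2.2 @[x --> F] --> z.2.2.
  by apply: cvg_trans (@cvg_snd _ _ (nbhs z.2.1) (nbhs z.2.2) _); apply: (cvg_app snd c2).
have cG m : Gfun b (coord x) m @[x --> F] --> Gfun b (coord z) m.
  by apply: cvg_Gfun => //; exact: cvg_cst.
have cG2 : Gfun b (coord x) x.2 @[x --> F] --> Gfun b (coord z) z.2.
  exact: cvg_Gfun.
have sz : simplex R q (coord z).
  split=> [i|].
    by apply: (cvgr_to_ge (c1 i)); apply: filterS nK => x [[+ _] _ _ _]; exact.
  have cs : (\sum_k coord x k) @[x --> F] --> \sum_k coord z k.
    exact: cvg_ord_sum.
  apply/eqP; rewrite eq_le; apply/andP; split.
    by apply: (cvgr_to_le cs); apply: filterS nK => x [[_ ->]].
  by apply: (cvgr_to_ge cs); apply: filterS nK => x [[_ ->]].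
split; first exact: sz.
- move=> Uz; have [_ /(_ _ Uz) [e e0 he]] := hU.
  have ne : \forall x \near F, forall k, `|coord x k - coord z k| < e.
    apply: filter_forall => k; have /cvgrPdist_lt/(_ _ e0) := c1 k.
    by apply: filterS => x; rewrite distrC.
  have : \forall x \near F, False.
    by apply: filterS2 nK ne => x [sx nUx _ _] hx; apply: nUx; exact: he.
  by move/filter_ex => [].
- split=> [|m mB].
    split; rewrite ler_norml; apply/andP; split.
    + apply: (cvgr_to_ge c21); apply: filterS nK => x [_ _ [[+ _] _] _].
      by rewrite ler_norml => /andP[].
    + apply: (cvgr_to_le c21); apply: filterS nK => x [_ _ [[+ _] _] _].
      by rewrite ler_norml => /andP[].
    + apply: (cvgr_to_ge c22); apply: filterS nK => x [_ _ [[_ +] _] _].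
      by rewrite ler_norml => /andP[].
    + apply: (cvgr_to_le c22); apply: filterS nK => x [_ _ [[_ +] _] _].
      by rewrite ler_norml => /andP[].
  rewrite -subr_ge0; apply: (cvgr_to_ge (cvgB (cG m) cG2)).
  by apply: filterS nK => x [_ _ [_ h] _]; rewrite subr_ge0; exact: h.
- by apply: (cvgr_to_le cG2); apply: filterS nK => x [].
Qed.

Lemma diss_bad_set :
  bad_set !=set0 -> (forall z, bad_set z -> 0 < diss b (coord z) z.2) ->
  exists2 d, 0 < d & forall z, bad_set z -> d < diss b (coord z) z.2.
Proof.
move=> K0 Kd.
have [|z zK zmin] := compact_EVT_min K0 compact_bad_set
    (f := fun z => diss b (coord z) z.2).
  apply: continuous_subspaceT => z; apply: cvg_diss => [k||].
  - apply: (@cvg_comp _ _ _ (fun x : 'rV[R]_q * (R * R) => x.1)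
      (fun w : 'rV[R]_q => w ord0 k) _ (nbhs z.1)); first exact: cvg_fst.
    exact: coord_continuous.
  - by apply: (@cvg_comp _ _ _ (fun x : 'rV[R]_q * (R * R) => x.2) fst _
      (nbhs z.2)); [exact: cvg_snd|exact: cvg_fst].
  - by apply: (@cvg_comp _ _ _ (fun x : 'rV[R]_q * (R * R) => x.2) snd _
      (nbhs z.2)); [exact: cvg_snd|exact: cvg_snd].
rewrite inE in zK; have dz := Kd _ zK.
(* Half of the attained minimum makes the bound strict. *)
exists (diss b (coord z) z.2 / 2); first by rewrite divr_gt0.
move=> x xK; apply: lt_le_trans (zmin x _); last by rewrite inE.
by rewrite ltr_pdivrMr// ltr_pMr// ltr1n.
Qed.

End sublevel.

Lemma critical_point (R : realType) q (b : R) (p : 'I_q -> R) (m : R * R) :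
  0 < b -> (0 < q)%N -> simplex R q p -> box_min b p m -> diss b p m = 0 ->
  p = unif R q /\ m = (0, 0) \/
  forall p' m', simplex R q p' -> Gfun b p m <= Gfun b p' m'.
Proof.
move=> b0 q0 sp mm d0; have [r pr] := diss_eq0 q0 sp d0.
have [fix_m _] := box_min_gibbs b0 q0 sp mm.
have [rE GE] := Gfun_proportional q0 sp pr.
have [m0|m0] := pselect (m = (0, 0)); [left|right].
  split=> //; apply/funext => k; rewrite /unif pr.
  have [_ p1] := sp; move: p1; rewrite (eq_bigr _ (fun k _ => pr k)) m0.
  under eq_bigr do rewrite Zsec0.
  rewrite sumr_const card_ord Zsec0 => p1.
  have qn : q%:R != 0 :> R by rewrite pnatr_eq0 -lt0n.
  by apply: (mulIf qn); rewrite mulVf// (mulr_natr _ q).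
move=> p' m' sp'; rewrite GE.
apply: le_trans (Gfun_ge_Ztot b m' q0 sp').
exact: radial_min pr fix_m m0.
Qed.

Lemma unif_simplex (R : realType) q : (0 < q)%N -> simplex R q (unif R q).
Proof.
move=> q0; split=> [i|]; first by rewrite /unif invr_ge0.
by rewrite sumr_const card_ord -[LHS]mulr_natr mulVf// pnatr_eq0 -lt0n.
Qed.

Theorem theorem1p8 (R : realType) (beta : R) (q : nat)
  (hbeta : 2 < beta) (hq : (0 < q)%N)
  (hsin : beta * sin (pi / q%:R) ^+ 2 < 1)
  (nu' : 'I_q -> R) (hnu : simplex R q nu')
  (hPsi : (Psi' beta nu' < Psi' beta (unif R q))%E)
  (U : set ('I_q -> R)) (hU : rel_open U) (hG : Gset beta q `<=` U)
  (phi : R -> 'I_q -> R) (hphi : is_flow beta nu' phi) :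
  exists t : R, 0 <= t /\ U (phi t).
Proof.
have b0 : 0 < beta by rewrite (lt_trans _ hbeta).
have su := @unif_simplex R q hq.
have PsiE p : simplex R q p -> Psi' beta p = ((Vfun beta p)%:E - freeE_inf beta)%E.
  by move=> sp; rewrite /Psi' /Psi (nu_of_spec b0 hq sp).2.
(* An infinite infimum would make the two values of [Psi'] equal, against their strict order. *)
have [e eE] : exists e, freeE_inf beta = e%:E :> \bar R.
  move: hPsi; rewrite !PsiE//; case: (freeE_inf beta) => [e _|//|//].
  by exists e.
have VP p p' : simplex R q p -> simplex R q p' ->
    (Psi' beta p <= Psi' beta p')%E = (Vfun beta p <= Vfun beta p').
  by move=> sp sp'; rewrite !PsiE// eE -!EFinB lee_fin lerD2r.
have Vlt : Vfun beta nu' < Vfun beta (unif R q).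
  by move: hPsi; rewrite !PsiE// eE -!EFinB lte_fin ltrD2r.
have Vge p : simplex R q p -> e <= Vfun beta p.
  move=> sp; have [mm _] := nu_of_spec b0 hq sp.
  have [_ gE] := box_min_gibbs b0 hq sp mm.
  rewrite -lee_fin -eE /Vfun -gE; apply: ereal_inf_lbound.
  by exists (gibbs beta p (mom (nu_of beta p))) => //; exact: density_gibbs.
apply: contrapT => noU.
have nU t : 0 <= t -> ~ U (phi t) by move=> t0 Ut; apply: noU; exists t.
have sphi t : 0 <= t -> simplex R q (phi t).
  by have [_ [h _]] := hphi; exact: h.
have Vphi t : 0 <= t -> Vfun beta (phi t) <= Vfun beta nu'.
  rewrite le_eqVlt => /predU1P[<-|t0].
    suff -> : phi 0 = nu' by [].
    by apply/funext => i; have [h _] := hphi; exact: h.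
  apply/ler_addgt0Pr => x x0.
  (* The negative rate - x / t lies strictly below the nonnegative dissipation and costs only x at
     time t. *)
  have /(Vfun_flow_decrease b0 hq hphi t0) : forall c, 0 < c ->
      - (x / t) < diss beta (phi c) (mom (nu_of beta (phi c))).
    by move=> c _; apply: lt_le_trans (diss_ge0 _ _ _); rewrite oppr_lt0 divr_gt0.
  by rewrite mulNr divfK ?gt_eqF// lerBlDr.
pose pt (t : R) : 'rV[R]_q * (R * R) :=
  (\row_k phi t k, mom (nu_of beta (phi t))).
have ptE t : (fun k => (pt t).1 ord0 k) = phi t.
  by apply/funext => k; rewrite /= mxE.
have pt_bad t : 0 <= t -> bad_set beta U (Vfun beta nu') (pt t).
  move=> t0; rewrite /bad_set /= ptE; split; [exact: sphi|exact: nU| |exact: Vphi].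
  exact: (nu_of_spec b0 hq (sphi _ t0)).1.
have [||d d0 dd] := @diss_bad_set R q beta U hU (Vfun beta nu').
- by exists (pt 0); exact: pt_bad.
- move=> z [sz nUz mz Gz]; rewrite lt_neqAle diss_ge0 andbT eq_sym.
  (* The uniform law has V above the sublevel bound; a global minimiser belongs to [Gset], hence to
     U. Neither is in the bad set. *)
  apply/eqP => /(critical_point b0 hq sz mz) [[pu m0]|pmin].
    have := Vfun_le b0 hq su mz.1; rewrite -pu leNgt => /negP; apply.
    by rewrite pu in Gz *; exact: le_lt_trans Gz Vlt.
  apply: nUz; apply: hG; split=> // p' sp'; rewrite VP//.
  by apply: le_trans (Vfun_le b0 hq sz mz.1) _; exact: pmin.
(* By this time the guaranteed decrease d t exceeds V(nu') - e, although e bounds V from below. *)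
pose t := (`|Vfun beta nu' - e| + 1) / d.
have t0 : 0 < t by rewrite divr_gt0// ltr_wpDl.
have dflow c : 0 < c -> d < diss beta (phi c) (mom (nu_of beta (phi c))).
  by move=> c0; have := dd _ (pt_bad _ (ltW c0)); rewrite ptE.
have := Vfun_flow_decrease b0 hq hphi t0 dflow.
have -> : d * t = `|Vfun beta nu' - e| + 1 by rewrite /t mulrC divfK// gt_eqF.
have := Vge _ (sphi _ (ltW t0)); have := ler_norm (Vfun beta nu' - e).
move: (Vfun beta (phi t)) (Vfun beta nu') `|_ - _| => x y z; lra.
Qed.
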